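(* Consider a right triangle with an acute angle $\alpha/2$, where $\alpha\notin\mathbb{Q}\cdot\pi$, and fix one of its legs. Then the set of points $x$ of this leg such that the billiard orbit starting at $x$ perpendicularly to the leg is not periodic has lower box dimension at most $1/2$.
   Context: Billiards in a polygon: a point mass moves with unit speed along straight lines inside the polygon and reflects at the sides by the rule angle of incidence equals angle of reflection; the orbit is not continued after it hits a vertex, and such an orbit is not periodic. Lower box dimension of $Y$: $\dim_{LB}Y=\liminf_{\epsilon\to0}\frac{\log N(\epsilon)}{\log(1/\epsilon)}$, where $N(\epsilon)$ is the minimal number of balls of radius $\epsilon$ needed to cover $Y$. *)

(* Defs.v *)
From HB Require Import structures.
From mathcomp Require Import all_boot all_order all_algebra.
From mathcomp Require Import all_classical all_reals all_analysis.

Set Implicit Arguments.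
Unset Strict Implicit.
Unset Printing Implicit Defensive.

Import Order.TTheory GRing.Theory Num.Theory.
Import numFieldNormedType.Exports.

Local Open Scope classical_set_scope.
Local Open Scope ring_scope.

Section Plane.
Variable R : realType.
Implicit Types u v x : 'rV[R]_2.

Definition dot u v : R := \sum_(i < 2) u 0 i * v 0 i.

(* The library norm `|u| on row vectors, hence also its ball, is the sup norm;
   the plane is used here with the Euclidean norm and Euclidean discs. *)
Definition enorm u : R := Num.sqrt (dot u u).

Definition disc x (e : R) : set 'rV[R]_2 := [set y | enorm (y - x) < e].

Definition angle u v : R := acos (dot u v / (enorm u * enorm v)).

End Plane.

Section LowerBoxDimension.
Variable R : realType.
Local Open Scope ereal_scope.

(* +oo if no finite family of discs covers Y. *)
Definition covering_number (Y : set 'rV[R]_2) (e : R) : \bar R :=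
  ereal_inf [set n%:R%:E | n in [set n : nat |
    exists c : 'I_n -> 'rV[R]_2, Y `<=` \bigcup_i disc (c i) e]].

Definition lower_box_dim (Y : set 'rV[R]_2) : \bar R :=
  limf_einf (fun e : R => lne (covering_number Y e) / (ln e^-1)%:E) 0^'+.

End LowerBoxDimension.

(* A triangle is the family P : 'I_3 -> 'rV[R]_2 of its vertices, with indices
   in the ring 'I_3 = Z/3; side i is the side opposite to the vertex P i, with
   endpoints P (i + 1) and P (i - 1). *)
Section TriangleBilliard.
Variables (R : realType) (P : 'I_3 -> 'rV[R]_2).

Definition noncollinear : bool :=
  row_free (col_mx (P 1 - P 0) (P 2 - P 0)).

Definition vertex_angle (i : 'I_3) : R :=
  angle (P (i + 1) - P i) (P (i - 1) - P i).

Definition inside : set 'rV[R]_2 :=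
  [set x | exists a : 'I_3 -> R, [/\ forall i, 0 < a i,
     \sum_(i < 3) a i = 1 & x = \sum_(i < 3) a i *: P i]].

Definition side (i : 'I_3) : set 'rV[R]_2 :=
  [set x | exists2 t : R, 0 <= t <= 1 &
     x = (1 - t) *: P (i + 1) + t *: P (i - 1)].

Definition open_side (i : 'I_3) : set 'rV[R]_2 :=
  [set x | exists2 t : R, 0 < t < 1 &
     x = (1 - t) *: P (i + 1) + t *: P (i - 1)].

(* The normalized altitude vector towards P i. *)
Definition inner_normal (i : 'I_3) : 'rV[R]_2 :=
  let e := P (i - 1) - P (i + 1) in
  let w := P i - P (i + 1) in
  let h := w - (dot w e / dot e e) *: e in
  (enorm h)^-1 *: h.

Definition reflection (i : 'I_3) (v : 'rV[R]_2) : 'rV[R]_2 :=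
  v - (2 * dot v (inner_normal i)) *: inner_normal i.

(* billiard_flow z t z': the phase point (position, velocity) z is carried to
   z' in time t.  A reflection takes no time, occurs only off the vertices, and
   only when the velocity points outwards, so that the motion is deterministic.
   An orbit reaching a vertex stops there: no reflection applies, and a flight
   through a vertex would leave the triangle. *)
Inductive billiard_flow :
    'rV[R]_2 * 'rV[R]_2 -> R -> 'rV[R]_2 * 'rV[R]_2 -> Prop :=
| flow_flight x v t : 0 < t ->
    (forall s, 0 < s < t -> inside (x + s *: v)) ->
    billiard_flow (x, v) t (x + t *: v, v)
| flow_reflection i x v : open_side i x -> dot v (inner_normal i) < 0 ->
    billiard_flow (x, v) 0 (x, reflection i v)
| flow_trans z1 z2 z3 t1 t2 : billiard_flow z1 t1 z2 ->
    billiard_flow z2 t2 z3 -> billiard_flow z1 (t1 + t2) z3.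

Definition periodic_orbit (z : 'rV[R]_2 * 'rV[R]_2) : Prop :=
  exists2 T : R, 0 < T & billiard_flow z T z.

End TriangleBilliard.

(* Main.v *)
Require Import Defs.
From mathcomp Require Import all_boot all_order all_algebra.
From mathcomp Require Import all_classical all_reals all_analysis.
From mathcomp Require Import ring lra zify.

Import Order.TTheory GRing.Theory Num.Theory.
Import numFieldNormedType.Exports.

Local Open Scope classical_set_scope.
Local Open Scope ring_scope.

(** The velocities along an orbit leaving a leg perpendicularly form a sparse
set.  Write th for the acute angle of the triangle at the end of the leg.
Reflection in a leg changes the heading phi of an orbit, measured from the
normal of the starting leg, into - phi or its opposite direction, and reflection
in the hypotenuse changes it into the direction opposite to 2 th - phi.  Hence,
up to reversal, phi is always an even multiple 2 n th, with n replaced by - n at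
a leg and by 1 - n at the hypotenuse, and an orbit gets from |n| <= N to |n| > N only by hitting the
hypotenuse with n = - N.  The flux through that gate is proportional to
|cos ((2 N + 1) th)|.  Since 2 th / pi is irrational, it has infinitely many
approximations by quotients of odd integers with error O(1 / q ^ 2), q being
the denominator, so that for infinitely many odd q = 2 N + 1 the gate has a
width of order 1 / q only ([odd_odd_approximation], [cos_near_odd_multiple]).

An orbit that comes back perpendicularly to its leg is periodic, for it then
retraces itself in both directions ([comes_home_periodic]).  So let x be a
starting point whose orbit never comes back, and let a small interval of
parallel orbits surround x.  Billiard reflections preserve the flux, so the
interval keeps its width across the flow as long as no orbit in it hits a
vertex.  If no such hit occurs and the interval never passes the gate, then it
moves for ever among finitely many velocities; as its images have a width
bounded from below, two of them overlap, and running time backwards brings an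
orbit of the interval back to the leg, hence the orbit of x too, a
contradiction.

Therefore every interval of radius eta around a nonreturning point contains a
point that hits a vertex before returning, with |n| <= N all along, or a point
that hits one of a set of grid points on the hypotenuse while passing the gate,
provided that the grid is fine enough for no image of the interval to slip
through it.  There are O(N) velocities, each with one line per side into the
opposite vertex; and when eta is of order 1 / q ^ 2, the images at a gate of
width O(1 / q) have a length of order 1 / q on the hypotenuse, so O(q) grid
points suffice.  Each marked point comes from at most one nonreturning starting
point, since the bounce map is injective.  Thus O(q) discs of radius 1 / q ^ 2
cover the starting points of nonperiodic orbits ([comes_home_or_near],
[nonperiodic_covering]) for infinitely many q, which gives the exponent 1/2
([lower_box_dim_le_half]).

The dynamics is treated in barycentric coordinates.  A phase point is a side
s, a velocity label l and the parameter t of a point on s; the velocity enters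
only through its three barycentric rates, which sum to zero, and reflection in
a side changes the sign of the rate of that side.  The bounce map is then a
piecewise affine map of one real variable. *)

(** * Indices modulo 3 *)

Lemma ord3E (s : 'I_3) :
  ((s + 1 + 1 = s - 1) * (s - 1 - 1 = s + 1)) *
  ((s + 1 - 1 = s) * (s - 1 + 1 = s)).
Proof. by do !split; case: s => -[|[|[|//]]] ?; apply: val_inj. Qed.

Lemma ord3_neq (s : 'I_3) :
  ((s + 1 == s) = false) * ((s - 1 == s) = false) *
  ((s + 1 == s - 1) = false) * ((s - 1 == s + 1) = false).
Proof. by case: s => -[|[|[|//]]]. Qed.

Lemma ord3_cases (s i : 'I_3) : [\/ i = s, i = s + 1 | i = s - 1].
Proof.
case: s => -[|[|[|//]]] ?; case: i => -[|[|[|//]]] ?; try (by constructor 1; apply: val_inj);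
 try (by constructor 2; apply: val_inj); by constructor 3; apply: val_inj.
Qed.

Lemma ord3_cover (k j m : 'I_3) : k != j -> k != m -> j != m ->
  forall i, [\/ i = k, i = j | i = m].
Proof.
move=> kj km jm i.
have [->|ki] := eqVneq i k; first by constructor 1.
have [->|ji] := eqVneq i j; first by constructor 2.
constructor 3; apply/val_inj; move: kj km jm ki ji; rewrite -!val_eqE /=.
by case: k j m i => [k ?] [j ?] [m ?] [i ?] /=; lia.
Qed.

Lemma sum_ord3 (V : nmodType) (F : 'I_3 -> V) (k j m : 'I_3) :
  k != j -> k != m -> j != m -> \sum_(i < 3) F i = F k + F j + F m.
Proof.
move=> kj km jm; have mkj : (m != k) && (m != j) by rewrite eq_sym km eq_sym.
rewrite (bigD1 k) //= (bigD1 j) 1?eq_sym //= (bigD1 m) //=.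
rewrite big1 ?addr0 ?addrA // => i /andP[/andP[ik ij] im].
by case: (ord3_cover _ _ _ kj km jm i) => e; move: ik ij im; rewrite e eqxx.
Qed.

Lemma ord3_neighbours (i l m : 'I_3) : i != l -> i != m -> l != m ->
  (l = i + 1 /\ m = i - 1) \/ (l = i - 1 /\ m = i + 1).
Proof.
move=> il im lm; case: (ord3_cases i l) il lm => -> //; rewrite ?eqxx // => _;
case: (ord3_cases i m) im => -> //; rewrite ?eqxx //; by [left | right].
Qed.

Lemma sum_sides (V : nmodType) (F : 'I_3 -> V) (s : 'I_3) :
  \sum_(i < 3) F i = F s + F (s + 1) + F (s - 1).
Proof. by apply: sum_ord3; rewrite 1?eq_sym ord3_neq. Qed.

(** * Transverse dynamics of the bounce map *)

Lemma pigeonhole_seq (T : eqType) (key : nat -> T) (S : seq T) :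
  (forall n, (n <= size S)%N -> key n \in S) ->
  exists n m, [/\ (n < m)%N, (m <= size S)%N & key n = key m].
Proof.
move=> keyS; have : ~~ uniq (mkseq key (size S).+1).
  apply: contraTN isT => /uniq_leq_size -/(_ S); rewrite size_mkseq ltnn; apply.
  by move=> _ /mapP[n + ->]; rewrite mem_iota ltnS => /keyS.
case/(uniqPn (key 0%N)) => n [m [nm ms]]; rewrite size_mkseq in ms.
by rewrite !nth_mkseq ?(ltn_trans nm) // => e; exists n, m.
Qed.

(** Used as the intermediate value theorem for affine maps: if two values had
opposite signs, then linear interpolation would give a zero in between. *)
Lemma affine_neg (R : realFieldType) (a c eta : R) :
  (forall x, `|x| < eta -> a + x * c != 0) -> a < 0 ->
  forall x, `|x| < eta -> a + x * c < 0.
Proof.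
move=> nz a0 x xe; case: ltgtP (nz x xe) => // b0 _; exfalso.
have xc0 : x * c > 0 by lra.
suff /nz : `|x * (- a / (x * c))| < eta.
  by rewrite mulrAC [_ * (- a / _)]mulrC (divfK (lt0r_neq0 xc0)) subrr eqxx.
apply: le_lt_trans xe; rewrite normrM ler_piMr //.
by rewrite ger0_norm ?ler_pdivrMr ?divr_ge0 ?mul1r //; lra.
Qed.

Section Bounce.
Variables (R : realType) (L : eqType).
(* [rate l i] is the derivative of the [i]-th barycentric coordinate along the
   velocity labelled [l]; it is positive when the velocity points away from
   side [i].  The label [refl s l] is that of the velocity reflected in [s]. *)
Variables (refl : 'I_3 -> L -> L) (rate : L -> 'I_3 -> R).
Hypothesis reflK : forall s, involutive (refl s).
Hypothesis rate_sum : forall l s, rate l s + rate l (s + 1) + rate l (s - 1) = 0.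
Hypothesis rate_refl : forall s l, rate (refl s l) s = - rate l s.

Definition state : Type := 'I_3 * L * R.

Lemma state_eq s s' l l' t t' :
  (s, l, t) = (s', l', t') :> state -> [/\ s = s', l = l' & t = t'].
Proof.
move=> e; split.
- exact: (congr1 (fun z : state => z.1.1) e).
- exact: (congr1 (fun z : state => z.1.2) e).
- exact: (congr1 (fun z : state => z.2) e).
Qed.

Definition leaving (z : state) : bool :=
  let: (s, l, t) := z in (0 < t < 1) && (0 < rate l s).

(** At time [1 / rate l s] the free flight from side [s] would reach the line
through the vertex [s] parallel to the side; it meets the vertex itself when
the coordinate [s - 1] vanishes at that time. *)
Definition singular (z : state) : bool :=
  let: (s, l, t) := z in t * rate l s + rate l (s - 1) == 0.

(** The sign of the quantity tested in [singular] tells on which side of the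
vertex [s] the flight passes, hence which side it hits first. *)
Definition bounce (z : state) : state :=
  let: (s, l, t) := z in
  if t * rate l s + rate l (s - 1) < 0
  then (s - 1, refl (s - 1) l, 1 + t * rate l s / rate l (s - 1))
  else (s + 1, refl (s + 1) l, - ((1 - t) * rate l s / rate l (s + 1))).

Arguments bounce : simpl never.

Variant bounce_spec (s : 'I_3) (l : L) (t : R) : state -> Prop :=
| BouncePrev of t * rate l s + rate l (s - 1) < 0 & rate l (s - 1) < 0
    & 0 < 1 + t * rate l s / rate l (s - 1) < 1 :
    bounce_spec s l t (s - 1, refl (s - 1) l, 1 + t * rate l s / rate l (s - 1))
| BounceNext of 0 < t * rate l s + rate l (s - 1) & rate l (s + 1) < 0
    & 0 < - ((1 - t) * rate l s / rate l (s + 1)) < 1 :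
    bounce_spec s l t
      (s + 1, refl (s + 1) l, - ((1 - t) * rate l s / rate l (s + 1))).

Lemma bounceP s l t : leaving (s, l, t) -> ~~ singular (s, l, t) ->
  bounce_spec s l t (bounce (s, l, t)).
Proof.
rewrite /bounce /= => /andP[/andP[t0 t1] r0] nz.
have rs := rate_sum l s; have tr : 0 < t * rate l s by rewrite mulr_gt0.
have tr1 : 0 < (1 - t) * rate l s by rewrite mulr_gt0 ?subr_gt0.
have divN (x y : R) : x / y = - (x / - y) by rewrite invrN mulrN opprK.
case: ltP => h.
  have rn : rate l (s - 1) < 0 by lra.
  constructor => //; rewrite divN.
  have h2 : 0 < t * rate l s / - rate l (s - 1) by rewrite divr_gt0 // oppr_gt0.
  have h3 : t * rate l s / - rate l (s - 1) < 1.
    by rewrite ltr_pdivrMr ?oppr_gt0 // mul1r; lra.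
  by apply/andP; split; lra.
have {}h : 0 < t * rate l s + rate l (s - 1) by rewrite lt_def nz.
have rn : rate l (s + 1) < 0 by lra.
constructor => //; rewrite divN opprK.
by rewrite divr_gt0 ?oppr_gt0 //= ltr_pdivrMr ?oppr_gt0 // mul1r; lra.
Qed.

Lemma bounce_leaving z : leaving z -> ~~ singular z -> leaving (bounce z).
Proof.
case: z => -[s l] t h1 h2; case: (bounceP _ _ _ h1 h2) => _ rn t01 /=;
by rewrite t01 rate_refl oppr_gt0.
Qed.

(** Two flights with the same velocity that start on different sides cannot
arrive at the same point of the third one: the starting point of the one would
lie on the flight of the other, inside the triangle. *)
Lemma bounce_sides_disjoint (u : 'I_3) (l : L) (v w : R) :
  0 < rate l (u + 1) -> v < 1 -> 0 < rate l (u - 1) -> 0 < w ->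
  1 + v * rate l (u + 1) / rate l u <> - ((1 - w) * rate l (u - 1) / rate l u).
Proof.
move=> a0 v1 b0 w0 /(congr1 ( *%R^~ (rate l u))).
have rs := rate_sum l u.
have un0 : rate l u != 0 by apply/eqP => e; lra.
rewrite mulrDl mulNr !divfK // mul1r => e.
have : 0 < (1 - v) * rate l (u + 1) by rewrite mulr_gt0 // subr_gt0.
have : 0 < w * rate l (u - 1) by rewrite mulr_gt0.
lra.
Qed.

Lemma bounce_inj z z' : leaving z -> leaving z' -> ~~ singular z ->
  ~~ singular z' -> bounce z = bounce z' -> z = z'.
Proof.
case: z => -[s l] t; case: z' => -[s' l'] t' h1 h1' h2 h2'.
have /= /andP[/andP[t0 t1] r0] := h1; have /= /andP[/andP[t0' t1'] r0'] := h1'.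
case: (bounceP _ _ _ h1 h2) => c rn _; case: (bounceP _ _ _ h1' h2') => c' rn' _.
- move=> /state_eq[/subIr es el et]; subst s'; have {}el := inv_inj (reflK _) el; subst l'.
  congr (_, _, _); move/addrI/mulIf: et; rewrite invr_eq0 lt_eqF // => /(_ isT).
  by apply/mulIf; rewrite gt_eqF.
- move=> /state_eq[es el et].
  have [u su su'] : exists2 u, s = u + 1 & s' = u - 1.
    by exists (s - 1); [|rewrite es]; rewrite ord3E.
  subst s s'; rewrite !ord3E in el et; have {}el := inv_inj (reflK _) el; subst l'.
  by have := bounce_sides_disjoint _ _ _ _ r0 t1 r0' t0' et.
- move=> /state_eq[es el et].
  have [u su su'] : exists2 u, s' = u + 1 & s = u - 1.
    by exists (s' - 1); [|rewrite -es]; rewrite ord3E.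
  subst s s'; rewrite !ord3E in el et; have {}el := inv_inj (reflK _) el; subst l'.
  by have := bounce_sides_disjoint _ _ _ _ r0' t1' r0 t0 (esym et).
- move=> /state_eq[/addIr es el et]; subst s'; have {}el := inv_inj (reflK _) el; subst l'.
  congr (_, _, _); move/oppr_inj/mulIf: et; rewrite invr_eq0 lt_eqF // => /(_ isT).
  by move/mulIf; rewrite gt_eqF // => /(_ isT) /subrI.
Qed.

Variables (j : 'I_3) (l0 : L).
Hypothesis rate0_gt0 : 0 < rate l0 j.

Definition trajectory (t : R) (n : nat) : state := iter n bounce (j, l0, t).

(** The side and the label decide: [l0] will be the label of the normal to the
leg, so that a state at home is a perpendicular departure from the leg. *)
Definition home (z : state) : bool := z.1 == (j, l0).

Definition regular (t : R) (n : nat) : Prop :=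
  forall m, (m < n)%N -> ~~ singular (trajectory t m).

Definition abroad (t : R) (n : nat) : Prop :=
  forall m, (m < n)%N -> ~~ home (trajectory t m.+1).

Definition comes_home (t : R) : Prop :=
  exists2 n, regular t n.+1 & home (trajectory t n.+1).

Lemma trajectory_leaving t n : 0 < t < 1 -> regular t n -> leaving (trajectory t n).
Proof.
move=> t01; elim: n => [|n IH] reg /=; first by rewrite t01.
apply: bounce_leaving; last exact: reg.
by apply: IH => m mn; apply: reg; rewrite ltnW.
Qed.

(** Injectivity of the bounce map, iterated: meeting trajectories were already
one trajectory, up to a shift in time. *)
Lemma trajectory_back n m t t' : 0 < t < 1 -> 0 < t' < 1 ->
  regular t n -> regular t' (n + m) -> trajectory t n = trajectory t' (n + m) ->
  trajectory t 0 = trajectory t' m.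
Proof.
move=> t01 t01'; elim: n => [//|n IH] reg reg' e.
have regS : regular t n by move=> i /ltnW; apply: reg.
have regS' : regular t' (n + m) by move=> i /ltnW; apply: reg'.
apply: IH => //; apply: bounce_inj => //; try exact: trajectory_leaving.
- exact: reg.
- exact: reg'.
Qed.

(** If the two arrival times differed, then going back along both trajectories
would put the longer one at home at a positive time. *)
Lemma abroad_inj t t' n n' : 0 < t < 1 -> 0 < t' < 1 ->
  regular t n -> regular t' n' -> abroad t n -> abroad t' n' ->
  trajectory t n = trajectory t' n' -> t = t'.
Proof.
wlog le : t t' n n' / (n <= n')%N => [W|].
  by case/orP: (leq_total n n') => ? *; [|apply: esym]; apply: W; eauto.
rewrite -(subnKC le); move: (n' - n)%N => [|m] t01 t01' reg reg' ab ab' e.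
  by have := trajectory_back _ _ _ _ t01 t01' reg reg' e => -[].
have := trajectory_back _ _ _ _ t01 t01' reg reg' e => e0.
have : ~~ home (trajectory t' m.+1) by apply: ab'; rewrite addnS ltnS leq_addl.
by rewrite -e0 /home eqxx.
Qed.

(* [A] lists the labels that are followed, and [G] those reached from them by
   a passage of the gate, which is possible on side [k] only. *)
Variables (A G : seq L) (k : 'I_3).
Hypothesis l0A : l0 \in A.
Hypothesis refl_closed : forall l s, l \in A ->
  refl s l \in A \/ s = k /\ refl s l \in G.
(* [M] is the fineness of the grid on side [k].  The flux through the gate has
   to be so small that an interval of radius [eta] on the starting side spreads
   over a whole mesh of the grid when it passes the gate. *)
Variables (eta : R) (M : nat).
Hypothesis eta_gt0 : 0 < eta.
Hypothesis gate_narrow : forall g, g \in G ->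
  rate g k <= eta * rate l0 j * M%:R.

(** The singular states over [A], and the grid points on side [k] with the
labels in [G].  The singular parameter is the zero of the affine expression in
[singular]. *)
Definition marks : seq state :=
  [seq (s, l, - (rate l (s - 1) / rate l s)) | s <- enum 'I_3, l <- A] ++
  [seq (k, g, m%:R / M%:R) | g <- G, m <- iota 0 M.+1].

Lemma size_marks : size marks = (3 * size A + size G * M.+1)%N.
Proof. by rewrite size_cat !size_allpairs size_enum_ord size_iota. Qed.

Definition reaches (w : state) (t : R) : Prop :=
  0 < t < 1 /\ exists2 n, regular t n /\ abroad t n & trajectory t n = w.

(** The only starting point whose trajectory meets [w] before coming home, and
0 if there is none. *)
Definition launch_of (w : state) : R := xget 0 (reaches w).

Lemma launch_of_reaches w t : reaches w t -> launch_of w = t.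
Proof.
move=> tw; rewrite /launch_of; case: xgetP => [t' _ | /(_ t)] // [t01' [n' [r' a'] e']].
case: tw => t01 [n [r a] e].
by apply: abroad_inj (r') (r) (a') (a) _ => //; rewrite e'.
Qed.

(** An interval of starting points that avoids the starting points of marks is
never cut: being cut means that it contains a singular point.  It is not let
through the gate either, since there it would cover a grid point.  Its speed
[d] of variation in the parameter of the side changes so that the flux
[`|d| * rate l s] is preserved. *)
Lemma travelling_interval t0 : eta <= t0 <= 1 - eta -> ~ comes_home t0 ->
  (forall w, w \in marks -> eta <= `|t0 - launch_of w|) ->
  forall n, exists q : 'I_3 * L * R * R, let: (s, l, p, d) := q in
    [/\ l \in A, `|d| * rate l s = rate l0 j &
      forall x, `|x| < eta -> [/\ regular (t0 + x) n, abroad (t0 + x) n &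
        trajectory (t0 + x) n = (s, l, p + x * d)]].
Proof.
move=> /andP[t0l t0r] nohome unmarked.
have in01 x : `|x| < eta -> 0 < t0 + x < 1.
  by rewrite ltr_norml => /andP[? ?]; apply/andP; split; lra.
have nomark n x : `|x| < eta -> regular (t0 + x) n -> abroad (t0 + x) n ->
    trajectory (t0 + x) n \notin marks.
  move=> xe r a; apply/negP => /unmarked.
  rewrite (@launch_of_reaches _ (t0 + x)); last by split; [exact: in01|exists n].
  by rewrite opprD addNKr normrN leNgt xe.
elim=> [|n [[[[s l] p] d] [lA flux H]]].
  by exists (j, l0, t0, 1); split=> [||x _]; rewrite ?normr1 ?mul1r ?mulr1.
have eta0 : `|0 : R| < eta by rewrite normr0.
have lv x : `|x| < eta -> leaving (s, l, p + x * d).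
  move=> xe; have [r a <-] := H x xe; apply: trajectory_leaving r; exact: in01.
have rs0 : 0 < rate l s by have /andP[] := lv 0 eta0.
have nsing x : `|x| < eta -> ~~ singular (s, l, p + x * d).
  move=> xe; have [r a e] := H x xe; have := nomark n x xe r a.
  rewrite e; apply: contraNN => /eqP sg; rewrite mem_cat; apply/orP; left.
  apply/allpairsP; exists (s, l); rewrite mem_enum /=; split => //.
  congr (_, _, _); apply: (mulIf (lt0r_neq0 rs0)).
  by rewrite mulNr divfK ?lt0r_neq0 //; lra.
have regS x : `|x| < eta -> regular (t0 + x) n.+1.
  move=> xe; have [r _ e] := H x xe.
  move=> m; rewrite ltnS leq_eqVlt => /orP[/eqP ->|/r//].
  by rewrite e nsing.
(* It remains to follow the interval through one bounce. *)
suff [s' [l' [p' [d' [lG flux' H']]]]] : exists s' l' p' d',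
    [/\ l' \in A \/ s' = k /\ l' \in G, `|d'| * rate l' s' = rate l0 j &
      forall x, `|x| < eta -> trajectory (t0 + x) n.+1 = (s', l', p' + x * d')].
  have nh : (s', l') != (j, l0).
    apply/eqP => e; apply: nohome; exists n; first by have := regS 0 eta0; rewrite addr0.
    by have := H' 0 eta0; rewrite addr0 => ->; rewrite /home /= e.
  have abS x : `|x| < eta -> abroad (t0 + x) n.+1.
    move=> xe; have [_ a _] := H x xe.
    move=> m; rewrite ltnS leq_eqVlt => /orP[/eqP ->|/a//].
    by rewrite H'.
  exists (s', l', p', d'); split=> [||x xe] //; last by split; [exact: regS|exact: abS|exact: H'].
  case: lG => // -[es l'G]; exfalso; subst s'.
  have /andP[/andP[p0 p1] rk0] : leaving (k, l', p').
    have := trajectory_leaving _ _ (in01 0 eta0) (regS 0 eta0).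
    by rewrite H' // mul0r addr0.
  have d0 : 0 < `|d'|.
    rewrite normr_gt0; apply/eqP => e; have := rate0_gt0.
    by rewrite -flux' e normr0 mul0r ltxx.
  have M0 : 0 < M%:R :> R.
    rewrite ltr0n lt0n; apply/eqP => e; have := gate_narrow _ l'G.
    by rewrite e mulr0 leNgt rk0.
  have wide : 1 <= eta * `|d'| * M%:R.
    have := gate_narrow _ l'G; rewrite -flux' => h.
    rewrite -(ler_pM2r rk0) mul1r; apply: le_trans h _.
    by rewrite le_eqVlt; apply/orP; left; apply/eqP; ring.
  have pM : 0 <= p' * M%:R by rewrite mulr_ge0 ?ltW.
  have /andP[m1 m2] := truncn_itv pM; set m := Num.truncn _ in m1 m2.
  (* The offset of the orbit that hits the grid point just below [p']. *)
  pose x := (m%:R / M%:R - p') / d'.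
  have xe : `|x| < eta.
    rewrite normrM normfV ltr_pdivrMr // -(ltr_pM2r M0); apply: lt_le_trans wide.
    rewrite -[X in _ * X < _](gtr0_norm M0) -normrM mulrBl divfK ?lt0r_neq0 //.
    rewrite ltr_norml.
    by move: m2; rewrite -natr1 => m2; apply/andP; split; lra.
  have := nomark n.+1 x xe (regS x xe) (abS x xe); rewrite H' // mem_cat negb_or.
  have dn0 : d' != 0 by rewrite -normr_gt0.
  have -> : p' + x * d' = m%:R / M%:R by rewrite /x divfK // addrC subrK.
  case/andP => _ /allpairsP[]; exists (l', m); split=> //.
    rewrite mem_iota leq0n add0n ltnS -(ler_nat R); apply: le_trans m1 _.
    by rewrite ler_piMl ?ltW.
(* The sign of this quantity selects the side that is hit. *)
have f0 : p * rate l s + rate l (s - 1) != 0.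
  by have := nsing 0 eta0; rewrite /= mul0r addr0.
have nz x : `|x| < eta ->
    (p * rate l s + rate l (s - 1)) + x * (d * rate l s) != 0.
  move=> /nsing; apply: contraNN => /eqP e; apply/eqP; rewrite -[RHS]e; ring.
have normdiv (r : R) : r < 0 -> `|d * rate l s / r| * - r = rate l0 j.
  move=> r0; rewrite -flux 2!normrM normfV (ltr0_norm r0) (gtr0_norm rs0) divfK //.
  by rewrite oppr_eq0 lt_eqF.
case: (ltgtP (p * rate l s + rate l (s - 1)) 0) f0 => // f0 _.
  have fneg := affine_neg _ _ _ _ nz f0.
  have rn : rate l (s - 1) < 0.
    case: (bounceP _ _ _ (lv 0 eta0) (nsing 0 eta0)) => + rn _;
      by rewrite ?mul0r ?addr0 // => ?; lra.
  exists (s - 1), (refl (s - 1) l), (1 + p * rate l s / rate l (s - 1)),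
    (d * rate l s / rate l (s - 1)); split.
  - exact: refl_closed.
  - by rewrite rate_refl normdiv.
  move=> x xe; rewrite /trajectory iterS -/(trajectory _ _); have [_ _ ->] := H x xe.
  rewrite /bounce; have := fneg x xe.
  have -> : p * rate l s + rate l (s - 1) + x * (d * rate l s) =
      (p + x * d) * rate l s + rate l (s - 1) by ring.
  by move=> ->; congr (_, _, _); ring.
have fpos x : `|x| < eta -> 0 < (p + x * d) * rate l s + rate l (s - 1).
  move=> xe; have := affine_neg _ (- (p * rate l s + rate l (s - 1))) (- (d * rate l s)) eta.
  move=> /(_ _ _ x xe) h; rewrite -oppr_lt0.
  have -> : - ((p + x * d) * rate l s + rate l (s - 1)) =
     - (p * rate l s + rate l (s - 1)) + x * - (d * rate l s) by ring.
  apply: h; last by rewrite oppr_lt0.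
  by move=> y ye; rewrite mulrN -opprD oppr_eq0; exact: nz.
have rn : rate l (s + 1) < 0.
  case: (bounceP _ _ _ (lv 0 eta0) (nsing 0 eta0)) => + rn _;
      by rewrite ?mul0r ?addr0 // => ?; lra.
exists (s + 1), (refl (s + 1) l), (- ((1 - p) * rate l s / rate l (s + 1))),
  (d * rate l s / rate l (s + 1)); split.
- exact: refl_closed.
- by rewrite rate_refl normdiv.
move=> x xe; rewrite /trajectory iterS -/(trajectory _ _); have [_ _ ->] := H x xe.
rewrite /bounce ltNge ltW ?fpos //=; congr (_, _, _); ring.
Qed.

(** The images of a travelling interval have lengths bounded from below for
each of the finitely many pairs of a side and a label, so two of them must
overlap.  By injectivity of the bounce map the overlap comes from a return to
the starting side. *)
Lemma comes_home_or_near t0 : 0 < t0 < 1 -> comes_home t0 \/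
  exists2 c, c \in [:: 0, 1 & map launch_of marks] & `|t0 - c| < eta.
Proof.
move=> /andP[t00 t01]; have [?|nohome] := pselect (comes_home t0); [by left|right].
have [t0e|t0e] := ltP t0 eta; first by exists 0; rewrite ?inE ?eqxx // subr0 gtr0_norm.
have [t1e|t1e] := ltP (1 - eta) t0.
  by exists 1; rewrite ?inE ?eqxx ?orbT // ltr0_norm; lra.
apply: contrapT => far.
have {}far w : w \in marks -> eta <= `|t0 - launch_of w|.
  move=> wm; rewrite leNgt; apply/negP => near; apply: far; exists (launch_of w) => //.
  by rewrite !inE map_f ?orbT.
have t0in : eta <= t0 <= 1 - eta by apply/andP.
have [q qP] := choice (travelling_interval t0 t0in nohome far).
(* With so many cells on the side [s], a cell is shorter than the images of
   the interval there. *)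
pose cells (sl : 'I_3 * L) :=
  (Num.truncn (rate sl.2 sl.1 / (eta * rate l0 j))).+1.
pose keys := [seq (sl, m) | sl <- [seq (s, l) | s <- enum 'I_3, l <- A],
                            m <- iota 0 (cells sl)].
pose key n := ((q n).1.1, Num.truncn ((q n).1.2 * (cells (q n).1.1)%:R)).
have eta0 : `|0 : R| < eta by rewrite normr0.
have in01 x : `|x| < eta -> 0 < t0 + x < 1.
  by rewrite ltr_norml => /andP[? ?]; apply/andP; split; lra.
have lv n : leaving (q n).1.
  have := qP n; case: (q n) => [[[s l] p] d] [_ _ /(_ 0 eta0)[r a e]].
  by have := trajectory_leaving _ _ (in01 0 eta0) r; rewrite e mul0r addr0.
have keyP n : key n \in keys.
  have := qP n; have := lv n; rewrite /key; case: (q n) => [[[s l] p] d].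
  case/andP=> /andP[p0 p1] _ [lA _ _].
  apply/allpairsPdep; exists (s, l), (Num.truncn (p * (cells (s, l))%:R)); split => //.
    by apply/allpairsP; exists (s, l); rewrite mem_enum.
  rewrite mem_iota add0n -(ltr_nat R) leq0n /=.
  have pc : 0 <= p * (cells (s, l))%:R by rewrite mulr_ge0 ?ltW.
  have /andP[c1 _] := truncn_itv pc; apply: le_lt_trans c1 _.
  by rewrite gtr_pMl // ltr0n.
have [n [m [nm _]]] := pigeonhole_seq _ _ _ (fun n _ => keyP n).
move: (qP n) (qP m) (lv n) (lv m); rewrite /key.
case: (q n) => [[[s l] p] d]; case: (q m) => [[[s' l'] p'] d'] /= [lA flux H] [_ _ H'].
case/andP=> /andP[p0 p1] rs0 /andP[/andP[p0' p1'] _].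
move/eqP; rewrite !xpair_eqE => /andP[/andP[/eqP es /eqP el] /eqP em]; subst s' l'.
pose c := cells (s, l); rewrite -/c in em.
have c0 : 0 < c%:R :> R by rewrite ltr0n.
have pc : 0 <= p * c%:R by rewrite mulr_ge0 ?ltW.
have pc' : 0 <= p' * c%:R by rewrite mulr_ge0 ?ltW.
have /andP[u1 u2] := truncn_itv pc; have /andP[u1' u2'] := truncn_itv pc'.
rewrite -em in u1' u2'; rewrite -natr1 in u2 u2'.
have d0 : 0 < `|d|.
  by rewrite normr_gt0; apply/eqP => e; have := rate0_gt0; rewrite -flux e normr0 mul0r ltxx.
(* The offset of the orbit that is at the [n]-th bounce where the orbit of
   [t0] is at the [m]-th. *)
pose x := (p' - p) / d.
have xe : `|x| < eta.
  rewrite normrM normfV ltr_pdivrMr // -(ltr_pM2r c0).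
  rewrite -[X in _ * X < _](gtr0_norm c0) -normrM mulrBl.
  apply: (@lt_trans _ _ 1); first by rewrite ltr_norml; apply/andP; split; lra.
  have : rate l s / (eta * rate l0 j) < c%:R.
    have h : 0 <= rate l s / (eta * rate l0 j) by rewrite divr_ge0 ?mulr_ge0 ?ltW.
    by have /andP[] := truncn_itv h.
  rewrite ltr_pdivrMr ?mulr_gt0 // -flux => h.
  rewrite -(ltr_pM2r rs0) mul1r; apply: lt_le_trans h _.
  by rewrite le_eqVlt; apply/orP; left; apply/eqP; ring.
have [r a e] := H x xe; have [r' a' e'] := H' 0 eta0.
have dn0 : d != 0 by rewrite -normr_gt0.
have ep : p + x * d = p' by rewrite /x divfK // addrC subrK.
have ep' : p' + 0 * d' = p' by rewrite mul0r addr0.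
rewrite ep' in e'; rewrite ep in e.
have em' : m = (n + (m - n).-1.+1)%N.
  by rewrite prednK ?subn_gt0 // subnKC // ltnW.
rewrite em' in r' e'.
have back := trajectory_back _ _ _ _ (in01 x xe) (in01 0 eta0) r r' (etrans e (esym e')).
have : ~~ home (trajectory (t0 + 0) (m - n).-1.+1).
  by apply: a'; rewrite [X in (_ < X)%N]em' addnS ltnS leq_addl.
by rewrite -back /home eqxx.
Qed.

End Bounce.

(** * The Euclidean plane *)

Section Dot.
Variable R : realType.
Implicit Types u v w : 'rV[R]_2.

Lemma dotE u v : dot u v = u 0 0 * v 0 0 + u 0 1 * v 0 1.
Proof.
rewrite /dot !big_ord_recl big_ord0 addr0.
by do 2 f_equal; congr (_ 0 _); apply: val_inj.
Qed.

Lemma dotC u v : dot u v = dot v u.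
Proof. by rewrite !dotE mulrC [X in _ + X]mulrC. Qed.

Lemma dotDl u v w : dot (u + v) w = dot u w + dot v w.
Proof. by rewrite !dotE !mxE; ring. Qed.

Lemma dotZl (a : R) u v : dot (a *: u) v = a * dot u v.
Proof. by rewrite !dotE !mxE; ring. Qed.

Lemma dotNl u v : dot (- u) v = - dot u v.
Proof. by rewrite -scaleN1r dotZl mulN1r. Qed.

Lemma dotDr u v w : dot w (u + v) = dot w u + dot w v.
Proof. by rewrite dotC dotDl !(dotC w). Qed.

Lemma dotZr (a : R) u v : dot v (a *: u) = a * dot v u.
Proof. by rewrite dotC dotZl dotC. Qed.

Lemma dotNr u v : dot v (- u) = - dot v u.
Proof. by rewrite dotC dotNl dotC. Qed.

Definition dotL := (dotDl, dotNl, dotZl, dotDr, dotNr, dotZr).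

Lemma dot_ge0 u : 0 <= dot u u.
Proof. by rewrite dotE addr_ge0 // -expr2 sqr_ge0. Qed.

Lemma dot_eq0 u : (dot u u == 0) = (u == 0).
Proof.
apply/idP/eqP => [|->]; last by rewrite dotE !mxE mul0r addr0.
rewrite dotE paddr_eq0 -?expr2 ?sqr_ge0 // !sqrf_eq0 => /andP[/eqP u0 /eqP u1].
apply/rowP => i; rewrite mxE; case: i => -[|[|//]] i.
  by rewrite -[RHS]u0; congr (u 0 _); apply: val_inj.
by rewrite -[RHS]u1; congr (u 0 _); apply: val_inj.
Qed.

Lemma enorm_sqr u : enorm u ^+ 2 = dot u u.
Proof. by rewrite sqr_sqrtr // dot_ge0. Qed.

Lemma enorm_gt0 u : (0 < enorm u) = (u != 0).
Proof. by rewrite sqrtr_gt0 lt_def dot_ge0 andbT dot_eq0. Qed.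

Lemma enormZ (a : R) u : enorm (a *: u) = `|a| * enorm u.
Proof. by rewrite /enorm dotZl dotZr mulrA -expr2 sqrtrM ?sqr_ge0 // sqrtr_sqr. Qed.

(** The difference is the square of the cross product. *)
Lemma cauchy_schwarz u v : dot u v ^+ 2 <= dot u u * dot v v.
Proof.
rewrite -subr_ge0.
have -> : dot u u * dot v v - dot u v ^+ 2 =
    (u 0 0 * v 0 1 - u 0 1 * v 0 0) ^+ 2 by rewrite !dotE; ring.
exact: sqr_ge0.
Qed.

Lemma cosine_itv u v : -1 <= dot u v / (enorm u * enorm v) <= 1.
Proof.
rewrite -ler_norml -sqrtr_sqr -[leRHS]sqrtr1 ler_wsqrtr //.
rewrite exprMn exprVn exprMn !enorm_sqr.
have [uv0|uv0] := eqVneq (dot u u * dot v v) 0; first by rewrite uv0 invr0 mulr0.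
rewrite ler_pdivrMr ?mul1r ?cauchy_schwarz //.
by rewrite lt_def uv0 mulr_ge0 ?dot_ge0.
Qed.

Lemma cos_angle u v : cos (angle u v) = dot u v / (enorm u * enorm v).
Proof. by have [] := acos_def (cosine_itv u v). Qed.

Lemma angleC u v : angle u v = angle v u.
Proof. by rewrite /angle dotC mulrC [enorm u * _]mulrC mulrC. Qed.

End Dot.

(** * Reversing the billiard flow *)

Section Flow.
Variables (R : realType) (P : 'I_3 -> 'rV[R]_2).

Lemma inside_barycentric s a b c (x : 'rV[R]_2) : 0 < a -> 0 < b -> 0 < c ->
  a + b + c = 1 -> x = a *: P s + b *: P (s + 1) + c *: P (s - 1) ->
  inside P x.
Proof.
move=> a0 b0 c0 abc ->.
pose w i := if i == s then a else if i == s + 1 then b else c.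
have wE : (w s = a) * (w (s + 1) = b) * (w (s - 1) = c).
  by rewrite /w !ord3_neq !eqxx.
exists w; split.
- by move=> i; case: (ord3_cases s i) => ->; rewrite wE.
- by rewrite (sum_sides _ _ s) !wE.
- by rewrite (sum_sides _ _ s) !wE.
Qed.

Lemma inner_normal_unit i : inner_normal P i != 0 ->
  dot (inner_normal P i) (inner_normal P i) = 1.
Proof.
rewrite /inner_normal; set h := _ - _ *: _ => nz.
have h0 : h != 0 by apply: contraNneq nz => ->; rewrite scaler0.
rewrite dotZl dotZr -enorm_sqr expr2 -enorm_gt0 in h0 *.
by rewrite mulKf ?mulVf ?gt_eqF.
Qed.

Lemma dot_reflection i v : inner_normal P i != 0 ->
  dot (reflection P i v) (inner_normal P i) = - dot v (inner_normal P i).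
Proof. move=> /inner_normal_unit; rewrite /reflection; move: (inner_normal P i) => n n1.
by rewrite !dotL n1; ring. Qed.

Lemma reflectionN i v : reflection P i (- v) = - reflection P i v.
Proof. by rewrite /reflection dotNl mulrN scaleNr opprD. Qed.

Lemma reflectionK i v : inner_normal P i != 0 ->
  reflection P i (reflection P i v) = v.
Proof.
move=> nz; rewrite {1}/reflection dot_reflection // mulrN scaleNr opprK.
by rewrite /reflection subrK.
Qed.

(** The time reversal of an outward hit is again an outward hit, because the
velocity that leaves a side is turned into one that arrives there. *)
Lemma flow_reverse x v t x' v' : billiard_flow P (x, v) t (x', v') ->
  billiard_flow P (x', - v') t (x, - v).
Proof.
move ez : (x, v) => z; move ez' : (x', v') => z' H.
elim: H x v x' v' ez ez' => {z t z'}.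
- move=> x v t t0 ins _ _ _ _ [-> ->] [-> ->].
  have {2}-> : x = (x + t *: v) + t *: - v by rewrite scalerN addrK.
  apply: flow_flight => // s /andP[s0 st].
  have -> : x + t *: v + s *: - v = x + (t - s) *: v.
    by rewrite scalerBl scalerN addrA.
  by apply: ins; rewrite subr_gt0 st gtrBl.
- move=> i x v xi vn _ _ _ _ [-> ->] [-> ->].
  have nz : inner_normal P i != 0.
    by apply: contraTneq vn => ->; rewrite dotE !mxE !mulr0 addr0 ltxx.
  have := @flow_reflection _ P i x (- reflection P i v) xi.
  by rewrite reflectionN reflectionK // dotNl dot_reflection // opprK; apply.
- move=> z1 [x2 v2] z3 t1 t2 _ IH1 _ IH2 x v x' v' e1 e3.
  rewrite addrC; apply: flow_trans; [exact: IH2 e3|exact: IH1].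
Qed.

(** A perpendicular hit reverses the velocity, so the orbit runs back to its
starting point, where it hits the leg perpendicularly again. *)
Lemma retracing_periodic j x v y t : 0 < t -> open_side P j x ->
  open_side P j y -> v = inner_normal P j -> v != 0 ->
  billiard_flow P (x, v) t (y, - v) -> periodic_orbit P (x, v).
Proof.
move=> t0 xj yj vE v0 fl.
have back u : open_side P j u -> billiard_flow P (u, - v) 0 (u, v).
  move=> uj; have {2}<- : reflection P j (- v) = v.
    rewrite reflectionN /reflection vE inner_normal_unit -?vE //.
    by rewrite mulr1 scaler_nat mulr2n opprB addrK.
  apply: flow_reflection => //.
  by rewrite dotNl vE inner_normal_unit -?vE // oppr_lt0.
exists (t + 0 + (t + 0)); first by rewrite !addr0 addr_gt0.
apply: flow_trans (flow_trans fl (back y yj)) _.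
apply: flow_trans (back x xj); rewrite -{1}[v]opprK.
exact: flow_reverse.
Qed.

End Flow.

(** * The bounce map is realized by the flow *)

Section Realization.
Variables (R : realType) (P : 'I_3 -> 'rV[R]_2) (L : eqType).
Variables (refl : 'I_3 -> L -> L) (rate : L -> 'I_3 -> R) (vel : L -> 'rV[R]_2).
Hypothesis reflK : forall s, involutive (refl s).
Hypothesis rate_sum : forall l s, rate l s + rate l (s + 1) + rate l (s - 1) = 0.
Hypothesis rate_refl : forall s l, rate (refl s l) s = - rate l s.
Hypothesis vel_rate : forall l, vel l = \sum_(i < 3) rate l i *: P i.
Hypothesis vel_refl : forall s l, vel (refl s l) = reflection P s (vel l).
Hypothesis vel_outwards : forall s l, rate l s < 0 ->
  dot (vel l) (inner_normal P s) < 0.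

Local Notation state := (state R L).
Local Notation leaving := (leaving R L rate).
Local Notation singular := (singular R L rate).
Local Notation bounce := (bounce R L refl rate).

Definition side_point (s : 'I_3) (t : R) : 'rV[R]_2 :=
  (1 - t) *: P (s + 1) + t *: P (s - 1).

Definition phase_point (z : state) : 'rV[R]_2 * 'rV[R]_2 :=
  (side_point z.1.1 z.2, vel z.1.2).

(** A coordinate that is positive at the start and nonnegative at the end of a
straight flight is positive in between. *)
Lemma segment_pos (x r T u : R) : 0 < x -> 0 <= x + T * r -> 0 < u < T ->
  0 < x + u * r.
Proof.
move=> x0 xT /andP[u0 uT]; have [r0|r0] := leP 0 r.
  by rewrite ltr_wpDr // mulr_ge0 // ltW.
by apply: le_lt_trans xT _; rewrite ltrD2l ltr_nM2r.
Qed.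

Lemma flight_inside s l t T : leaving (s, l, t) ->
  0 <= 1 - t + T * rate l (s + 1) -> 0 <= t + T * rate l (s - 1) ->
  forall u, 0 < u < T -> inside P (side_point s t + u *: vel l).
Proof.
move=> /andP[/andP[t0 t1] rs0] h1 h2 u uT; have /andP[u0 _] := uT.
apply: (@inside_barycentric _ _ s (u * rate l s) (1 - t + u * rate l (s + 1))
          (t + u * rate l (s - 1))).
- by rewrite mulr_gt0.
- by apply: segment_pos uT => //; rewrite subr_gt0.
- exact: segment_pos uT.
- have /(congr1 ( *%R u)) := rate_sum l s; rewrite mulr0 !mulrDr => e; lra.
rewrite vel_rate (sum_sides _ _ s) /side_point.
by apply/rowP => c; rewrite !mxE; ring.
Qed.

(** The flight up to the next side, before the reflection there.  The last
flight of a returning orbit is used in this form. *)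
Lemma flow_to_bounce z : leaving z -> ~~ singular z ->
  exists2 T, 0 < T & billiard_flow P (phase_point z) T
    (side_point (bounce z).1.1 (bounce z).2, vel z.1.2).
Proof.
case: z => -[s l] t lv nsg; have /andP[/andP[t0 t1] r0] := lv.
have rs := rate_sum l s.
have rn1 : rate l (s + 1) = - rate l s - rate l (s - 1) by lra.
rewrite /phase_point.
case: (bounceP R L refl rate rate_sum s l t lv nsg) =>
  [_ rn /andP[b0 b1]|_ rn /andP[b0 b1]]; cbn [fst snd].
- exists (- t / rate l (s - 1)).
    by rewrite -mulrNN -invrN opprK divr_gt0 // oppr_gt0.
  have rz : rate l (s - 1) != 0 by rewrite lt_eqF.
  set T := - t / _.
  have -> : side_point (s - 1) (1 + t * rate l s / rate l (s - 1)) =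
      side_point s t + T *: vel l.
    rewrite vel_rate (sum_sides _ _ s) /side_point !ord3E rn1 /T.
    by apply/rowP => c; rewrite !mxE; field.
  apply: flow_flight; first by rewrite /T -mulrNN -invrN opprK divr_gt0 // oppr_gt0.
  apply: flight_inside => //.
    have -> : 1 - t + T * rate l (s + 1) = 1 + t * rate l s / rate l (s - 1).
      by rewrite rn1 /T; field.
    exact: ltW.
  by rewrite /T divfK // subrr.
- have rz : rate l (s + 1) != 0 by rewrite lt_eqF.
  have rn2 : rate l (s - 1) = - rate l s - rate l (s + 1) by lra.
  set T := - (1 - t) / rate l (s + 1).
  have T0 : 0 < T by rewrite /T -mulrNN -invrN opprK divr_gt0 ?oppr_gt0 // subr_gt0.
  exists T => //.
  have -> : side_point (s + 1) (- ((1 - t) * rate l s / rate l (s + 1))) =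
      side_point s t + T *: vel l.
    rewrite vel_rate (sum_sides _ _ s) /side_point !ord3E rn2 /T.
    by apply/rowP => c; rewrite !mxE; field.
  apply: flow_flight => //; apply: flight_inside => //.
    by rewrite /T divfK // subrr.
  have -> : t + T * rate l (s - 1) = 1 + (1 - t) * rate l s / rate l (s + 1).
    by rewrite rn2 /T; field.
  by rewrite -[X in _ <= _ + X]opprK subr_ge0 ltW.
Qed.

Lemma flow_bounce z : leaving z -> ~~ singular z ->
  exists2 T, 0 < T & billiard_flow P (phase_point z) T (phase_point (bounce z)).
Proof.
move=> lv nsg; have [T T0 fl] := flow_to_bounce z lv nsg.
exists (T + 0); first by rewrite addr0.
apply: flow_trans fl _.
have lv' := bounce_leaving R L refl rate rate_sum rate_refl z lv nsg.
have e : (bounce z).1.2 = refl (bounce z).1.1 z.1.2.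
  by case: (z) => -[s l] t; rewrite /bounce; case: ifP.
rewrite /phase_point e vel_refl; move: lv' e; case: (bounce z) => -[s' l'] t' /=.
case/andP => t01 r0 e; apply: flow_reflection; first by exists t'.
by apply: vel_outwards; rewrite -oppr_gt0 -rate_refl -e.
Qed.

Variables (j : 'I_3) (l0 : L).
Hypothesis rate0_gt0 : 0 < rate l0 j.
Hypothesis vel0 : vel l0 = inner_normal P j.

(** Just before it is at home, the orbit has the velocity reflected from the
normal of the leg, that is, the opposite of the normal. *)
Lemma comes_home_periodic t : 0 < t < 1 ->
  comes_home R L refl rate j l0 t ->
  periodic_orbit P (side_point j t, inner_normal P j).
Proof.
move=> t01 [n reg /eqP home]; rewrite -vel0.
pose tr := trajectory R L refl rate j l0 t.
have lv m : (m <= n)%N -> leaving (tr m).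
  move=> mn; apply: trajectory_leaving => // i im; apply: reg.
  by rewrite (leq_trans im) // (leq_trans mn).
have nsg m : (m <= n)%N -> ~~ singular (tr m) by move=> mn; apply: reg.
have fl m : (m <= n)%N -> m = 0%N \/ exists2 T, 0 < T &
    billiard_flow P (phase_point (tr 0)) T (phase_point (tr m)).
  elim: m => [|m IH] mn; [by left | right].
  have [T T0 step] := flow_bounce _ (lv m (ltnW mn)) (nsg m (ltnW mn)).
  have [m0|[T' T'0 fl]] := IH (ltnW mn); first by exists T => //; subst m.
  by exists (T' + T); [exact: addr_gt0 | exact: flow_trans fl step].
have [T T0 last] := flow_to_bounce _ (lv n (leqnn n)) (nsg n (leqnn n)).
have [y [T' T'0 [toy [y01 ln]]]] : exists y, exists2 T', 0 < T' &
    billiard_flow P (phase_point (tr 0)) T' (side_point j y, vel (tr n).1.2) /\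
    0 < y < 1 /\ refl j (tr n).1.2 = l0.
  have lvS := bounce_leaving R L refl rate rate_sum rate_refl _ (lv n (leqnn n)) (nsg n (leqnn n)).
  have e : (bounce (tr n)).1.2 = refl (bounce (tr n)).1.1 (tr n).1.2.
    by case: (tr n) => -[s l] u; rewrite /bounce; case: ifP.
  have home1 : (bounce (tr n)).1.1 = j := congr1 fst home.
  have home2 : (bounce (tr n)).1.2 = l0 := congr1 snd home.
  rewrite home1 in last e; exists (bounce (tr n)).2.
  have y01 : 0 < (bounce (tr n)).2 < 1.
    by move: lvS; case: (bounce (tr n)) => -[s l] u /andP[].
  have [n0|[T' T'0 fln]] := fl n (leqnn n).
    by exists T => //; split; [have -> : tr 0 = tr n by rewrite n0 | split=> //; rewrite -e].
  exists (T' + T); first exact: addr_gt0.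
  by split; [exact: flow_trans fln last | split=> //; rewrite -e].
have nz : vel l0 != 0.
  apply/eqP => v0; have := vel_outwards j (tr n).1.2.
  rewrite -oppr_gt0 -rate_refl ln => /(_ rate0_gt0).
  by rewrite -vel0 v0 dotE !mxE !mulr0 addr0 ltxx.
have vn : vel (tr n).1.2 = - vel l0.
  rewrite -(reflK j (tr n).1.2) ln vel_refl /reflection vel0.
  by rewrite inner_normal_unit -?vel0 // mulr1 scaler_nat mulr2n opprD addrA subrr sub0r.
apply: (retracing_periodic R P j _ _ (side_point j y) T' T'0) => //; last by rewrite -vn.
- by exists t.
- by exists y.
Qed.

End Realization.

(** * Normals and angles of a triangle *)

Section TriangleGeometry.
Variables (R : realType) (P : 'I_3 -> 'rV[R]_2).

(** Coinciding vertices give a linear relation between the two edge vectors. *)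
Lemma noncollinear_inj : noncollinear P -> injective P.
Proof.
move=> nc.
have indep (x y : R) : x *: (P 1 - P 0) + y *: (P 2 - P 0) = 0 -> x = 0 /\ y = 0.
  move=> xy0; have : row_mx x%:M y%:M = 0 :> 'rV[R]_(1 + 1).
    apply: (row_free_inj nc).
    by rewrite mul0mx mul_row_col !mul_scalar_mx.
  rewrite -row_mx0 => /eq_row_mx[/matrixP /(_ 0 0) + /matrixP /(_ 0 0)].
  by rewrite !mxE eqxx !mulr1n.
have P10 : P 1 <> P 0.
  move=> e; have [|] := indep 1 0; last by move/eqP; rewrite oner_eq0.
  by rewrite e subrr scaler0 scale0r addr0.
have P20 : P 2 <> P 0.
  move=> e; have [|_] := indep 0 1; last by move/eqP; rewrite oner_eq0.
  by rewrite e subrr scaler0 scale0r addr0.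
have P21 : P 2 <> P 1.
  move=> e; have [|] := indep 1 (-1); last by move/eqP; rewrite oner_eq0.
  by rewrite e scaleN1r scale1r subrr.
have cover i : [\/ i = 0, i = 1 | i = 2 :> 'I_3] by apply: ord3_cover.
by move=> i l; case: (cover i) => ->; case: (cover l) => -> // e; exfalso; auto.
Qed.

Lemma vertex_angleE (i l m : 'I_3) : i != l -> i != m -> l != m ->
  vertex_angle P i = angle (P l - P i) (P m - P i).
Proof.
by move=> il im lm; case: (ord3_neighbours _ _ _ il im lm) => -[-> ->] //; rewrite angleC.
Qed.

(** In the plane the orthogonal complement of [e] is the line spanned by [u]. *)
Lemma plane_orthogonal (u e w : 'rV[R]_2) : dot u u = 1 -> dot u e = 0 ->
  e != 0 -> w - (dot w e / dot e e) *: e = dot w u *: u.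
Proof.
rewrite -dot_eq0 => u1 ue0 e0.
suff E c : w 0 c - dot w e / dot e e * e 0 c = dot w u * u 0 c.
  by apply/rowP => c; rewrite !mxE E.
apply: (mulIf e0); rewrite mulrBl mulrAC divfK //.
have c01 : c = 0 \/ c = 1 by case: c => -[|[|//]] ?; [left|right]; apply: val_inj.
rewrite !dotE in u1 ue0 *.
pose K := e 0 1 * u 0 0 - e 0 0 * u 0 1.
have eK : e 0 0 = - (K * u 0 1).
  rewrite -[LHS]mulr1 -u1 /K; apply/eqP; rewrite -subr_eq0; apply/eqP.
  by rewrite -(mulr0 (u 0 0)) -ue0; ring.
have eK' : e 0 1 = K * u 0 0.
  rewrite -[LHS]mulr1 -u1 /K; apply/eqP; rewrite -subr_eq0; apply/eqP.
  by rewrite -(mulr0 (u 0 1)) -ue0; ring.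
apply/eqP; rewrite -subr_eq0; apply/eqP.
have z : 1 - (u 0 0 * u 0 0 + u 0 1 * u 0 1) = 0 by rewrite u1 subrr.
case: c01 => ->; rewrite {}eK {}eK'; move: K => K.
- rewrite -[RHS](mulr0 (K * K * u 0 0 * (w 0 0 * u 0 0 + w 0 1 * u 0 1))) -z; ring.
- rewrite -[RHS](mulr0 (K * K * u 0 1 * (w 0 0 * u 0 0 + w 0 1 * u 0 1))) -z; ring.
Qed.

(** Two conditions that are easy to verify characterize the normal, whatever
the orientation of the triangle. *)
Lemma inner_normalE (u : 'rV[R]_2) (i l m : 'I_3) :
  injective P -> i != l -> i != m -> l != m ->
  dot u u = 1 -> dot u (P l - P m) = 0 -> 0 < dot u (P i - P m) ->
  inner_normal P i = u.
Proof.
move=> injP il im lm u1 ulm uim.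
have key a b : a != b -> dot u (P a - P b) = 0 -> 0 < dot u (P i - P b) ->
    let w := P i - P b in let e := P a - P b in
    (enorm (w - (dot w e / dot e e) *: e))^-1 *: (w - (dot w e / dot e e) *: e) = u.
  move=> ab uab ub w e; rewrite (plane_orthogonal u e w u1 uab); last first.
    by rewrite subr_eq0; apply: contraNneq ab => /injP ->.
  rewrite enormZ dotC gtr0_norm // scalerA.
  have -> : enorm u = 1 by rewrite /enorm u1 sqrtr1.
  by rewrite mulr1 mulVf ?scale1r // gt_eqF.
case: (ord3_neighbours _ _ _ il im lm) => -[el em]; rewrite /inner_normal -el -em.
  apply: key; first by rewrite eq_sym.
    by rewrite -opprB dotNr ulm oppr0.
  have -> : P i - P l = (P i - P m) - (P l - P m) by rewrite opprB addrA subrK.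
  by rewrite dotDr dotNr ulm subr0.
exact: key.
Qed.

End TriangleGeometry.

(** * Approximation by quotients of odd integers *)

(** Modulo 2 the vectors [(p, q)] and [(p', q')] are a basis of the plane over
the field with two elements, so [(1, 1)] is one of them or their sum. *)
Lemma odd_determinant (p p' : int) (q q' : nat) :
  p' * q%:Z - q'%:Z * p = 1 ->
  [|| odd q && odd `|p|, odd q' && odd `|p'| | odd (q + q') && odd `|p + p'|].
Proof.
move=> det.
have half (z : int) : exists x e, z = 2 * x + e /\ (e = 0 \/ e = 1).
  by exists (z %/ 2)%Z, (z %% 2)%Z; lia.
have [x [e [ex xe]]] := half p; have [x' [e' [ex' xe']]] := half p'.
have [y [f [fy yf]]] := half q; have [y' [f' [fy' yf']]] := half q'.
rewrite ex ex' fy fy' in det.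
have {det} [z] : exists z, e' * f - f' * e = 2 * z + 1.
  exists (y' * e + 2 * y' * x + f' * x - 2 * x' * y - x' * f - e' * y); lra.
by case: xe => ?; case: xe' => ?; case: yf => ?; case: yf' => ?; subst e e' f f'; lia.
Qed.

Lemma odd_halves (u : nat) (s : int) : odd u -> odd `|s| ->
  [/\ u = u./2.*2.+1, s = 2 * ((s - 1) %/ 2)%Z + 1 & (0 < u)%N].
Proof. by move=> *; split; lia. Qed.

Section Approximation.
Variable R : realType.
Implicit Types b : R.

(** Pigeonhole on the fractional parts of the first [Q + 1] multiples of [b]. *)
Lemma dirichlet b (Q : nat) : (0 < Q)%N ->
  exists q (p : int), [/\ (0 < q <= Q)%N, coprime q `|p|%N &
    `|q%:R * b - p%:~R| * Q%:R < 1].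
Proof.
move=> Q0; have Q0' : 0 < Q%:R :> R by rewrite ltr0n.
pose fr i : R := i%:R * b - (Num.floor (i%:R * b))%:~R.
have fr01 i : 0 <= fr i /\ fr i < 1.
  have /andP[h1 h2] := floor_itv (i%:R * b); rewrite intrD in h2.
  by rewrite /fr; split; lra.
have frQ i : 0 <= Q%:R * fr i by case: (fr01 i) => *; rewrite mulr_ge0 // ltW.
have keyP i : (i <= size (iota 0 Q))%N ->
    Num.truncn (Q%:R * fr i) \in iota 0 Q.
  move=> _; have /andP[h1 _] := truncn_itv (frQ i).
  rewrite mem_iota leq0n add0n -(ltr_nat R); apply: le_lt_trans h1 _.
  by rewrite gtr_pMr //; case: (fr01 i).
have [n [m [nm mQ e]]] := pigeonhole_seq _ _ _ keyP.
rewrite size_iota in mQ.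
have /andP[n1 n2] := truncn_itv (frQ n); have /andP[m1 m2] := truncn_itv (frQ m).
rewrite -e in m1 m2; rewrite -natr1 in n2 m2.
pose q := (m - n)%N.
pose p := Num.floor (m%:R * b) - Num.floor (n%:R * b).
have q0 : (0 < q)%N by rewrite subn_gt0.
have qQ : (q <= Q)%N by apply: leq_trans mQ; rewrite leq_subr.
have close : `|q%:R * b - p%:~R| * Q%:R < 1.
  rewrite -[X in _ * X < _](gtr0_norm Q0') -normrM natrB 1?ltnW // intrB.
  by rewrite ltr_norml /fr in n1 n2 m1 m2 *; apply/andP; split; lra.
(* Dividing out the common factor only improves the approximation. *)
have g0 : (0 < gcdn q `|p|)%N by rewrite gcdn_gt0 q0.
set g := gcdn q `|p|%N in g0.
have gq : (g %| q)%N := dvdn_gcdl _ _.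
have gp : (g %| p)%Z by rewrite dvdzE; exact: dvdn_gcdr.
exists (q %/ g)%N, (p %/ g)%Z; split.
- by rewrite divn_gt0 // dvdn_leq // (leq_trans _ qQ) // leq_div.
- have : coprime (q %/ g) (`|p| %/ g).
    rewrite /coprime -(eqn_pmul2l g0) muln_gcdr muln1 ![(g * _)%N]mulnC.
    by rewrite !divnK // dvdn_gcdr.
  suff -> : (`|p| %/ g)%N = `|(p %/ g)%Z|%N by [].
  have := divzK gp; move: (p %/ g)%Z => r <-; rewrite abszM mulnK //.
- apply: le_lt_trans close; rewrite ler_pM2r //.
  have g1 : 1 <= g%:R :> R by rewrite ler1n.
  have -> : q%:R * b - p%:~R =
      g%:R * ((q %/ g)%N%:R * b - ((p %/ g)%Z)%:~R) :> R.
    rewrite -{1}(divzK gp) -{1}(divnK gq) natrM intrM; ring.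
  by rewrite normrM ger0_norm ?ler_peMl // ltW // (lt_le_trans _ g1).
Qed.

Lemma irrational_gap b (B : nat) :
  (forall (q : nat) (p : int), (0 < q)%N -> q%:R * b != p%:~R) ->
  exists2 d : R, 0 < d &
    forall q (p : int), (0 < q <= B)%N -> d <= `|q%:R * b - p%:~R|.
Proof.
move=> irr; elim: B => [|B [d d0 dP]]; first by exists 1 => // q p; case: q.
pose x := B.+1%:R * b; pose f : R := (Num.floor x)%:~R.
have /andP[f1 f2] := floor_itv x; rewrite intrD -/f in f1 f2.
have fx : f < x by rewrite lt_neqAle f1 eq_sym irr.
exists (Num.min d (Num.min (x - f) (f + 1 - x))).
  by rewrite !lt_min d0; apply/andP; split; lra.
move=> q p /andP[q0]; rewrite leq_eqVlt ltnS => /orP[/eqP ->|qB]; last first.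
  by rewrite ge_min dP // q0.
rewrite !ge_min -/x; apply/orP; right; have [pf|pf] := leP p (Num.floor x).
  have : p%:~R <= f by rewrite ler_int.
  by move=> h; apply/orP; left; rewrite ler_normr; apply/orP; left; lra.
have : f + 1 <= p%:~R by rewrite /f -[1]/(1%:~R) -intrD ler_int; lia.
by move=> h; apply/orP; right; rewrite ler_normr; apply/orP; right; lra.
Qed.

(** The Bezout coefficient of [p], reduced modulo [q].  The fractions [p / q] and
[p' / q'] differ by [1 / (q * q')], so the second one approximates [b] with an
error of that order. *)
Lemma unimodular_partner b q (p : int) : (0 < q)%N -> coprime q `|p|%N ->
  `|q%:R * b - p%:~R| * q%:R <= 1 ->
  exists q' (p' : int), [/\ (q' < q)%N, p' * q%:Z - q'%:Z * p = 1 &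
    `|q'%:R * b - p'%:~R| * q%:R <= 2].
Proof.
move=> q0 cop err; have [u [v uv]] := Bezoutz q p.
have {}uv : u * q%:Z + v * p = 1 by rewrite uv /gcdz /= (eqP cop).
pose r := (- v %% q%:Z)%Z.
have r0 : 0 <= r by rewrite modz_ge0 // -lt0n.
have rq : r < q%:Z by rewrite ltz_pmod.
have er := divz_eq (- v) q%:Z; rewrite -/r in er; set w := (- v %/ q%:Z)%Z in er.
exists `|r|%N, (u - w * p); have absr : (`|r|%N : int) = r by rewrite gez0_abs.
have det : (u - w * p) * q%:Z - r * p = 1.
  rewrite -uv; have -> : v = - (w * q%:Z + r) by rewrite -er opprK.
  ring.
split; first by rewrite -ltz_nat absr.
  by rewrite absr.
have q0' : 0 < q%:R :> R by rewrite ltr0n.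
have rR : `|r|%N%:R = r%:~R :> R by rewrite -absr.
have detR : (u - w * p)%:~R * q%:R - r%:~R * p%:~R = 1 :> R.
  by rewrite -[q%:R]/(q%:Z%:~R) -!intrM -intrB det.
have r0' : 0 <= r%:~R :> R by rewrite ler0z.
have rq' : r%:~R <= q%:R :> R by rewrite -[q%:R]/(q%:Z%:~R) ler_int ltW.
rewrite rR -[X in _ * X <= _](gtr0_norm q0') -normrM.
have -> : (r%:~R * b - (u - w * p)%:~R) * q%:R =
    r%:~R * (q%:R * b - p%:~R) - 1 :> R by lra.
move: err; set y := q%:R * b - _ => err.
apply: le_trans (ler_normB _ _) _; rewrite normr1 normrM ger0_norm //.
have : r%:~R * `|y| <= q%:R * `|y| by rewrite ler_wpM2r.
lra.
Qed.

(** Among a good approximation [p / q], its unimodular partner [p' / q'] and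
their mediant, one has an odd numerator and an odd denominator.  Its error is
at most [3 / q] and its denominator at most [2 * q], whence the constant 6; the
denominator is large because a small denominator would give a large error. *)
Lemma odd_odd_approximation b (B : nat) :
  (forall (q : nat) (p : int), (0 < q)%N -> q%:R * b != p%:~R) ->
  exists N (r : int), (B <= N)%N /\
    `|(N.*2.+1)%:R * b - (2 * r + 1)%:~R| * (N.*2.+1)%:R <= 6.
Proof.
move=> irr; have [d d0 dP] := irrational_gap b B.*2.+1 irr.
(* By the choice of [d], an error of at most [3 / q] with [q > q0] forces a
   denominator beyond [2 * B + 1]. *)
pose q0 := (Num.truncn (3 / d)).+1.
have dq0 : 3 < d * q0%:R.
  have h : 0 <= 3 / d by rewrite divr_ge0 // ltW.
  by have /andP[_] := truncn_itv h; rewrite ltr_pdivrMr // mulrC.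
have [d' d'0 d'P] := irrational_gap b q0 irr.
pose Q := (Num.truncn d'^-1).+1.
have dQ : 1 < d' * Q%:R.
  have h : 0 <= d'^-1 by rewrite invr_ge0 ltW.
  by have /andP[_] := truncn_itv h; rewrite -[X in X < _]mul1r ltr_pdivrMr // mulrC.
have [q [p [/andP[q1 qQ] cop close]]] := dirichlet b Q isT.
have q0q : (q0 < q)%N.
  rewrite ltnNge; apply/negP => qq0; have := d'P q p; rewrite q1 qq0 => /(_ isT) h.
  suff : d' * Q%:R <= `|q%:R * b - p%:~R| * Q%:R by move=> ?; lra.
  by rewrite ler_wpM2r.
have qR0 : 0 < q%:R :> R by rewrite ltr0n.
have err1 : `|q%:R * b - p%:~R| * q%:R <= 1.
  apply: le_trans (ltW close); rewrite ler_wpM2l // ler_nat //.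
have [q' [p' [q'q det err2]]] : exists q' (p' : int), [/\ (q' < q)%N,
    p' * q%:Z - q'%:Z * p = 1 & `|q'%:R * b - p'%:~R| * q%:R <= 2].
  exact: unimodular_partner.
have found (u : nat) (s : int) : (u <= q + q')%N -> odd u -> odd `|s| ->
    `|u%:R * b - s%:~R| * q%:R <= 3 -> exists N (r : int), (B <= N)%N /\
    `|(N.*2.+1)%:R * b - (2 * r + 1)%:~R| * (N.*2.+1)%:R <= 6.
  move=> uq ou os err; exists u./2, ((s - 1) %/ 2)%Z.
  have [eu es u0] := odd_halves _ _ ou os.
  rewrite -eu -es.
  have u2q : (u <= 2 * q)%N by rewrite mul2n -addnn (leq_trans uq) // leq_add2l ltnW.
  split.
    rewrite leqNgt; apply/negP => uB.
    have h : d <= `|u%:R * b - s%:~R| 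
      by apply: dP; rewrite u0 eu ltnS leq_double ltnW.
    suff : 3 < `|u%:R * b - s%:~R| * q%:R by move=> ?; lra.
    apply: lt_le_trans dq0 _; apply: ler_pM => //; [exact: ltW|by rewrite ler_nat ltnW].
  have : u%:R <= 2 * q%:R :> R by rewrite -natrM ler_nat.
  move=> u2; apply: (@le_trans _ _ (`|u%:R * b - s%:~R| * (2 * q%:R))).
    by rewrite ler_wpM2l.
  lra.
have [/andP[oq op]|/andP[oq op]|/andP[oq op]] := or3P (odd_determinant _ _ _ _ det).
- by apply: (found q p) => //; [rewrite leq_addr | lra].
- by apply: (found q' p') => //; [rewrite leq_addl | lra].
apply: (found (q + q')%N (p + p')) => //.
rewrite natrD intrD.
have -> : (q%:R + q'%:R) * b - (p%:~R + p'%:~R) =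
   (q%:R * b - p%:~R) + (q'%:R * b - p'%:~R) :> R by ring.
have := ler_normD (q%:R * b - p%:~R) (q'%:R * b - p'%:~R).
rewrite -(ler_pM2r qR0) mulrDl; lra.
Qed.

Lemma normr_sin_le (x : R) : `|sin x| <= `|x|.
Proof.
wlog x0 : x / 0 <= x => [W|].
  have [/W//|/ltW x0] := leP 0 x.
  by rewrite -normrN -sinN -[X in _ <= X]normrN W // oppr_ge0.
have [c _] := @MVT_segment R sin cos 0 x x0 (fun y _ => is_derive_sin y)
  (continuous_subspaceT (@continuous_sin R)).
rewrite sin0 !subr0 => ->; rewrite normrM.
by rewrite ler_piMl // cos_max.
Qed.

Lemma normr_sinDint (r : int) (x : R) : `|sin (r%:~R * pi + x)| = `|sin x|.
Proof.
elim/int_rec: r x => [|n IH|n IH] x; first by rewrite mul0r add0r.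
  by rewrite intS intrD mulrDl mul1r -addrA addrC sinDpi normrN IH.
rewrite -[in RHS](subrK pi x) sinDpi normrN -(IH (x - pi)).
by congr `|sin _|; rewrite intS !rmorphN rmorphD /=; ring.
Qed.

(** The cosine vanishes at the odd multiples of [pi / 2] and is 1-Lipschitz;
the factor 2 is a bound for [pi / 2]. *)
Lemma cos_near_odd_multiple (t : R) (q : nat) (r : int) :
  `|cos (q%:R * t)| <= 2 * `|q%:R * (2 * t / pi) - (2 * r + 1)%:~R|.
Proof.
set y : R := _ - _; have pi0 : pi != 0 :> R by rewrite gt_eqF ?pi_gt0.
have -> : q%:R * t = (r%:~R * pi + pi / 2 * y) + pi / 2.
  by rewrite /y intrD intrM; move: (pi : R) pi0 => P P0; field.
rewrite cosDpihalf normrN normr_sinDint; apply: le_trans (normr_sin_le _) _.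
have := pihalf_lt2 R; have := pi_gt0 R => h1 h2.
by rewrite normrM ler_wpM2r // ger0_norm ?divr_ge0 // ?ltW.
Qed.

End Approximation.

(** * Perpendicular orbits in a right triangle *)

Lemma absz_1B (N : nat) (n : int) : (absz n <= N)%N ->
  (absz (1 - n) <= N)%N \/ 1 - n = N.+1%:Z.
Proof. by lia. Qed.

Section RightTriangle.
Variables (R : realType) (P : 'I_3 -> 'rV[R]_2) (k j m : 'I_3).
Variables (f1 f2 : 'rV[R]_2) (a b c th : R).
Hypotheses (kj : k != j) (km : k != m) (jm : j != m) (injP : injective P).
Hypotheses (f11 : dot f1 f1 = 1) (f22 : dot f2 f2 = 1) (f12 : dot f1 f2 = 0).
Hypotheses (a0 : 0 < a) (b0 : 0 < b) (c0 : 0 < c).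
Hypotheses (Pm : P m = P k + a *: f1) (Pj : P j = P k + b *: f2).
Hypotheses (cos_th : cos th = a / c) (sin_th : sin th = b / c).

(** The label [(s, n)] stands for the heading [2 * n * th], with the direction
reversed if [s] is true. *)
Definition label : Type := bool * int.

Definition sgn (l : label) : R := (-1) ^+ l.1.

Definition heading (l : label) : R := (2 * l.2)%:~R * th.

Definition vel (l : label) : 'rV[R]_2 :=
  sgn l *: (sin (heading l) *: f1 + cos (heading l) *: f2).

Definition refl (i : 'I_3) (l : label) : label :=
  if i == j then (~~ l.1, - l.2)
  else if i == m then (l.1, - l.2) else (~~ l.1, 1 - l.2).

Definition rate (l : label) (i : 'I_3) : R :=
  if i == j then sgn l * (cos (heading l) / b)
  else if i == m then sgn l * (sin (heading l) / a)
  else - (sgn l * (sin (heading l) / a + cos (heading l) / b)).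

Let mj : (m == j) = false. Proof. by rewrite eq_sym (negbTE jm). Qed.

Let rateE l : (rate l j = sgn l * (cos (heading l) / b)) *
  (rate l m = sgn l * (sin (heading l) / a)) *
  (rate l k = - (sgn l * (sin (heading l) / a + cos (heading l) / b))).
Proof. by rewrite /rate eqxx mj eqxx (negbTE kj) (negbTE km). Qed.

Let reflE l : (refl j l = (~~ l.1, - l.2)) * (refl m l = (l.1, - l.2)) *
  (refl k l = (~~ l.1, 1 - l.2)).
Proof. by rewrite /refl eqxx mj eqxx (negbTE kj) (negbTE km). Qed.

Let sgnN s n n' : sgn (~~ s, n) = - sgn (s, n').
Proof. by rewrite /sgn; case: s; rewrite /= expr0 expr1 ?opprK. Qed.

Let headingN s s' n : heading (s, - n) = - heading (s', n).
Proof. by rewrite /heading /= mulrN intrN mulNr. Qed.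

Let heading1B s s' n : heading (s, 1 - n) = th - (heading (s', n) - th).
Proof. by rewrite /heading /= mulrBr mulr1 intrB; ring. Qed.

(** The hypotenuse has the normal direction of heading [th]. *)
Lemma rate_hypotenuse l :
  rate l k = - (sgn l * (c / (a * b)) * cos (heading l - th)).
Proof.
rewrite rateE cosB cos_th sin_th; congr (- _); field.
by rewrite !gt_eqF.
Qed.

Lemma refl_involutive i : involutive (refl i).
Proof.
move=> [s n]; case: (ord3_cover _ _ _ kj km jm i) => ->; rewrite !reflE /=.
- by rewrite negbK subKr.
- by rewrite negbK opprK.
- by rewrite opprK.
Qed.

Lemma rate_sum_side l s : rate l s + rate l (s + 1) + rate l (s - 1) = 0.
Proof.
rewrite -sum_sides (sum_ord3 _ _ _ _ _ kj km jm) !rateE; ring.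
Qed.

Lemma rate_refl_side i l : rate (refl i l) i = - rate l i.
Proof.
case: l => s n; case: (ord3_cover _ _ _ kj km jm i) => ->.
- rewrite !rate_hypotenuse reflE /= (sgnN _ _ n) (heading1B _ s).
  have -> : th - (heading (s, n) - th) - th = - (heading (s, n) - th) by ring.
  by rewrite cosN; ring.
- by rewrite reflE !rateE /= (sgnN _ _ n) (headingN _ s) cosN; ring.
- by rewrite reflE !rateE /= (headingN _ s) sinN /sgn /=; ring.
Qed.

Lemma vel_rate_sum l : vel l = \sum_(i < 3) rate l i *: P i.
Proof.
rewrite (sum_ord3 _ _ _ _ _ kj km jm) !rateE Pm Pj /vel.
apply/rowP => i; rewrite !mxE; field.
by rewrite !gt_eqF.
Qed.

Lemma inner_normal_j : inner_normal P j = f2.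
Proof.
apply: (@inner_normalE _ _ _ j k m) => //; first by rewrite eq_sym.
  by rewrite Pm opprD addNKr !dotL dotC f12; ring.
by rewrite Pm Pj opprD addrACA subrr add0r !dotL f22 (dotC _ f2) f12 mulr0 oppr0 addr0 mulr1.
Qed.

Lemma inner_normal_m : inner_normal P m = f1.
Proof.
apply: (@inner_normalE _ _ _ m k j) => //; rewrite ?[m == _]eq_sym //.
  by rewrite Pj opprD addNKr !dotL f12; ring.
by rewrite Pm Pj opprD addrACA subrr add0r !dotL f11 f12 mulr0 oppr0 addr0 mulr1.
Qed.

Lemma inner_normal_k : inner_normal P k = - (sin th *: f1 + cos th *: f2).
Proof.
apply: (@inner_normalE _ _ _ k j m) => //.
- rewrite !dotL f11 f22 f12 (dotC _ f2) f12 -[RHS](cos2Dsin2 th); ring.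
- have -> : P j - P m = b *: f2 - a *: f1.
    by rewrite Pm Pj opprD addrACA subrr add0r.
  rewrite !dotL f11 f22 f12 (dotC _ f2) f12 cos_th sin_th.
  by field; rewrite gt_eqF.
- have -> : P k - P m = - (a *: f1) by rewrite Pm opprD addNKr.
  rewrite !dotL f11 (dotC _ f2) f12 sin_th.
  rewrite [X in 0 < X](_ : _ = a * (b / c)); last by ring.
  by rewrite mulr_gt0 ?divr_gt0.
Qed.

Lemma dot_vel_normal l :
  (dot (vel l) (inner_normal P j) = b * rate l j) *
  (dot (vel l) (inner_normal P m) = a * rate l m) *
  (dot (vel l) (inner_normal P k) = (a * b / c) * rate l k).
Proof.
rewrite inner_normal_j inner_normal_m inner_normal_k; split; [split|].
- by rewrite rateE /vel !dotL f12 f22; field; rewrite gt_eqF.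
- by rewrite rateE /vel !dotL f11 (dotC _ f2) f12; field; rewrite gt_eqF.
- rewrite rate_hypotenuse /vel !dotL f11 f22 f12 (dotC _ f2) f12 cosB; field.
  by rewrite !gt_eqF.
Qed.

Lemma vel_outwards_side i l : rate l i < 0 -> dot (vel l) (inner_normal P i) < 0.
Proof.
by case: (ord3_cover _ _ _ kj km jm i) => -> r0; 
  rewrite dot_vel_normal pmulr_rlt0 // ?divr_gt0 ?mulr_gt0.
Qed.

Lemma vel_refl_side i l : vel (refl i l) = reflection P i (vel l).
Proof.
case: l => s n; case: (ord3_cover _ _ _ kj km jm i) => ->; rewrite /reflection dot_vel_normal.
- rewrite inner_normal_k rate_hypotenuse reflE /vel /= (sgnN _ _ n) (heading1B _ s).
  have [y ->] : exists y, heading (s, n) = y + th.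
    by exists (heading (s, n) - th); rewrite subrK.
  rewrite !addrK sinB cosB sinD cosD; apply/rowP => i0; rewrite !mxE; field.
  by rewrite !gt_eqF.
- rewrite inner_normal_j rateE reflE /vel /= (sgnN _ _ n) (headingN _ s) sinN cosN.
  by apply/rowP => i0; rewrite !mxE; field; rewrite gt_eqF.
- rewrite inner_normal_m rateE reflE /vel /= (headingN _ s) sinN cosN /sgn /=.
  by apply/rowP => i0; rewrite !mxE; field; rewrite gt_eqF.
Qed.

Definition labels (N : nat) : seq label :=
  [seq (s, x%:Z - N%:Z) | s <- [:: false; true], x <- iota 0 N.*2.+1].

Lemma mem_labels N l : (l \in labels N) = (`|l.2| <= N)%N.
Proof.
case: l => s n; apply/allpairsP/idP => /= [[[s' x] /= [_ + [_ ->]]]|nN].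
  by rewrite (mem_iota 0 N.*2.+1) => ?; lia.
exists (s, absz (n + N%:Z)); split => /=; [by case: s | by rewrite (mem_iota 0 N.*2.+1); lia |].
by congr (_, _); lia.
Qed.

Definition exits (N : nat) : seq label := [:: (false, N.+1%:Z); (true, N.+1%:Z)].

Lemma refl_labels N l i : l \in labels N ->
  refl i l \in labels N \/ i = k /\ refl i l \in exits N.
Proof.
case: l => s n; rewrite !mem_labels => nN.
case: (ord3_cover _ _ _ kj km jm i) => ->; rewrite reflE; [|left|left] => /=.
- case: (absz_1B _ _ nN) => [|->]; [by left|right; split=> //].
  by rewrite !inE !xpair_eqE !eqxx !andbT; case: (s).
- by rewrite abszN.
- by rewrite abszN.
Qed.

(** The heading [2 * (N + 1) * th] makes the angle [(2 * N + 1) * th] with the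
normal of the hypotenuse. *)
Lemma rate_exits N g : g \in exits N ->
  rate g k <= c / (a * b) * `|cos ((N.*2.+1)%:R * th)|.
Proof.
move=> gN; have [s ->] : exists s, g = (s, N.+1%:Z).
  by move: gN; rewrite !inE => /orP[] /eqP ->; eexists.
rewrite rate_hypotenuse; have -> : heading (s, N.+1%:Z) - th = N.*2.+1%:R * th.
  rewrite /heading /= -[in RHS]muln2 -!natr1 natrM intrM -[N.+1%:~R]natr1.
  by rewrite -[2%:~R]/(2%:R : R); ring.
apply: le_trans (ler_norm _) _; rewrite normrN 2!normrM /sgn normrX normrN1 expr1n.
by rewrite mul1r [`|c / _|]gtr0_norm ?divr_gt0 ?mulr_gt0.
Qed.

Lemma side_length : enorm (P (j - 1) - P (j + 1)) = a.
Proof.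
have e : enorm (a *: f1) = a by rewrite enormZ gtr0_norm // /enorm f11 sqrtr1 mulr1.
have jk : j != k by rewrite eq_sym.
have e' : P m - P k = a *: f1 by rewrite Pm addrC addKr.
case: (ord3_neighbours _ _ _ jk jm km) => -[<- <-]; first by rewrite e'.
by rewrite -opprB e' -[RHS]e /enorm dotNl dotNr opprK.
Qed.

(** The radius [eta], measured in the parameter of the leg, is [q ^- 2 / a].
The gate has flux at most [12 * c / (a * b * q)], and the interval has flux
[eta / b]; so a grid of [12 * c * q] meshes meets the requirement of
[comes_home_or_near]. *)
Lemma nonperiodic_covering :
  (forall (q : nat) (p : int), (0 < q)%N -> q%:R * (2 * th / pi) != p%:~R) ->
  exists C, forall B, exists q, [/\ (B <= q)%N, (0 < q)%N & exists2 s : seq 'rV[R]_2,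
    (size s <= C * q)%N &
    forall x, side P j x /\ ~ periodic_orbit P (x, inner_normal P j) ->
      exists2 o, o \in s & disc o (q%:R ^- 2) x].
Proof.
move=> irr; exists (2 * (Num.truncn (12 * c)).+1 + 10)%N => B.
have [N [r [BN appr]]] := odd_odd_approximation _ _ B irr.
set q := N.*2.+1 in appr; exists q; split=> //; first by rewrite /q; lia.
have q0 : 0 < q%:R :> R by rewrite ltr0n.
pose eta : R := q%:R ^- 2 / a.
pose M := ((Num.truncn (12 * c)).+1 * q)%N.
have eta0 : 0 < eta by rewrite divr_gt0 ?invr_gt0 ?exprn_gt0.
pose l0 : label := (false, 0).
have rl0 : rate l0 j = b^-1.
  by rewrite rateE /sgn /heading /= mulr0 mul0r cos0 expr0 !mul1r.
have rate0 : 0 < rate l0 j by rewrite rl0 invr_gt0.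
have l0in : l0 \in labels N by rewrite mem_labels.
have narrow g : g \in exits N -> rate g k <= eta * rate l0 j * M%:R.
  move=> /rate_exits /le_trans; apply.
  have X : `|cos (q%:R * th)| * q%:R <= 12.
    apply: le_trans (ler_wpM2r (ltW q0) (cos_near_odd_multiple R th q r)) _.
    by rewrite -[leLHS]mulrA (le_trans (ler_wpM2l (ler0n R 2) appr)) // -natrM ler_nat.
  have /andP[_ K] := truncn_itv (mulr_ge0 (ler0n R 12) (ltW c0)).
  have -> : eta * rate l0 j * M%:R =
      (Num.truncn (12 * c)).+1%:R * (q%:R * (a * b))^-1.
    by rewrite /eta rl0 /M natrM; field; rewrite !gt_eqF.
  rewrite ler_pdivlMr ?mulr_gt0 //; apply: le_trans (ltW K).
  have -> : c / (a * b) * `|cos (q%:R * th)| * (q%:R * (a * b)) =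
      c * (`|cos (q%:R * th)| * q%:R).
    by field; rewrite !gt_eqF.
  by rewrite mulrC ler_wpM2r // ltW.
have near := comes_home_or_near R label refl rate refl_involutive rate_sum_side
  rate_refl_side j l0 rate0 (labels N) (exits N) k l0in (refl_labels N) eta M eta0 narrow.
set cs := [:: 0, 1 & _] in near.
exists (map (side_point R P j) cs).
  rewrite size_map /cs /= size_map size_marks size_allpairs size_iota /M /q.
  by move: (Num.truncn _) => K /=; clear; lia.
move=> x [[t t01 xE] nper].
have close o : o \in cs -> `|t - o| < eta ->
    exists2 o, o \in map (side_point R P j) cs & disc o (q%:R ^- 2) x.
  move=> ocs o_near; exists (side_point R P j o); first exact: map_f.
  have -> : x = side_point R P j t by [].
  rewrite /disc /=.
  have -> : side_point R P j t - side_point R P j o =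
      (t - o) *: (P (j - 1) - P (j + 1)).
    by rewrite /side_point; apply/rowP => i; rewrite !mxE; ring.
  by rewrite enormZ side_length -ltr_pdivlMr.
have [t00|t0] := eqVneq t 0.
  by apply: (close 0); rewrite ?inE ?eqxx // t00 subrr normr0.
have [t11|t1] := eqVneq t 1.
  by apply: (close 1); rewrite ?inE ?eqxx ?orbT // t11 subrr normr0.
have t01' : 0 < t < 1.
  by case/andP: t01 => ? ?; apply/andP; split; rewrite lt_neqAle ?t1 1?eq_sym ?t0.
have [home|[y ycs ty]] := near t t01'; last exact: close ycs ty.
exfalso; apply: nper; rewrite xE.
apply: (@comes_home_periodic R P label refl rate vel _ _ _ _ _ _ j l0 rate0 _ t t01' home).
- exact: refl_involutive.
- exact: rate_sum_side.
- exact: rate_refl_side.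
- exact: vel_rate_sum.
- exact: vel_refl_side.
- exact: vel_outwards_side.
- rewrite inner_normal_j /vel /sgn /heading /= mulr0 mul0r sin0 cos0 expr0.
  by rewrite scale0r add0r !scale1r.
Qed.

End RightTriangle.

(** * From coverings to the lower box dimension *)

Section BoxDimension.
Variable R : realType.

Lemma covering_number_le (Y : set 'rV[R]_2) (e : R) (s : seq 'rV[R]_2) :
  (forall x, Y x -> exists2 c, c \in s & disc c e x) ->
  (covering_number Y e <= (size s)%:R%:E)%E.
Proof.
move=> sY; apply: ereal_inf_lbound; exists (size s) => //.
exists (fun i : 'I_(size s) => nth 0 s i) => x /sY[c cs xc].
have i : (index c s < size s)%N by rewrite index_mem.
by exists (Ordinal i) => //=; rewrite nth_index.
Qed.

Lemma covering_number_ge0 (Y : set 'rV[R]_2) (e : R) :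
  (0 <= covering_number Y e)%E.
Proof. by apply: le_ereal_inf_tmp => _ [n _ <-]; rewrite lee_fin. Qed.

(** With [e = q ^- 2] the quotient of logarithms is at most
[(ln C + ln q) / (2 * ln q)], which tends to 1/2. *)
Lemma lower_box_dim_le_half (Y : set 'rV[R]_2) (C : nat) :
  (forall B, exists q, [/\ (B <= q)%N, (0 < q)%N & exists2 s : seq 'rV[R]_2,
     (size s <= C * q)%N &
     forall x, Y x -> exists2 c, c \in s & disc c (q%:R ^- 2) x]) ->
  (lower_box_dim Y <= (1 / 2)%:E)%E.
Proof.
move=> covers; rewrite /lower_box_dim limf_einfE.
apply: ge_ereal_sup => _ [V V0 <-]; apply/lee_addgt0Pr => d d0.
have [e e0 eV] : exists2 e : R, 0 < e & forall x, 0 < x -> x < e -> V x.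
  have [e e0 eV] := V0; exists e => // x x0 xe; apply: eV => //=.
  by rewrite sub0r normrN gtr0_norm.
pose K : R := ln (maxn C 1)%:R.
pose B := ((Num.truncn (expR (K / (2 * d)))).+2 + (Num.truncn e^-1).+1)%N.
have [q [Bq q0 [s sC sY]]] := covers B.
have qR0 : 0 < q%:R :> R by rewrite ltr0n.
have q1 : 1 < q%:R :> R by rewrite ltr1n; apply: leq_trans Bq; rewrite /B; lia.
have lnq : 0 < ln (q%:R : R) by rewrite ln_gt0.
have Kq : K <= 2 * d * ln (q%:R : R).
  rewrite mulrC -ler_pdivrMr; last by rewrite mulr_gt0.
  rewrite -ler_expR lnK ?posrE //.
  have /andP[_ h] := truncn_itv (expR_ge0 (K / (2 * d))).
  by apply: le_trans (ltW h) _; rewrite ler_nat; apply: leq_trans Bq; rewrite /B; lia.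
have qe : q%:R ^- 2 < e.
  have h : 0 <= e^-1 by rewrite invr_ge0 ltW.
  have /andP[_ {}h] := truncn_itv h.
  rewrite -[e]invrK ltf_pV2 ?posrE ?invr_gt0 ?exprn_gt0 //.
  apply: lt_le_trans h _; apply: (@le_trans _ _ q%:R).
    by rewrite ler_nat; apply: leq_trans Bq; rewrite /B; lia.
  by rewrite expr2 ler_peMl // ltW.
set f := (X in X @` V).
apply: (@le_trans _ _ (f (q%:R ^- 2))).
  by apply: ereal_inf_lbound; exists (q%:R ^- 2) => //; apply: eV => //; rewrite invr_gt0 exprn_gt0.
rewrite /f invrK lnXn //.
have cov : (lne (covering_number Y (q%:R ^- 2)) <= (K + ln (q%:R : R))%:E)%E.
  have -> : K + ln (q%:R : R) = ln (((maxn C 1) * q)%N%:R).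
    by rewrite natrM lnM // posrE ltr0n; lia.
  rewrite -lne_EFin; last by rewrite ltr0n; lia.
  rewrite lee_lne ?in_itv /= ?leey ?covering_number_ge0 ?lee_fin ?ler0n //.
  apply: le_trans (covering_number_le _ _ _ sY) _; rewrite lee_fin ler_nat.
  by apply: leq_trans sC _; rewrite leq_mul2r; lia.
rewrite inver gt_eqF ?pmulrn_lgt0 //.
apply: le_trans (lee_wpmul2r _ cov) _.
  by rewrite lee_fin invr_ge0 ltW // pmulrn_lgt0.
rewrite -EFinM -EFinD lee_fin ler_pdivrMr ?pmulrn_lgt0 // mulr2n.
set l := ln _ in Kq *; have -> : (1 / 2 + d) * (l + l) = 2 * d * l + l by field.
by rewrite lerD2r.
Qed.

End BoxDimension.

(** * The dimension bound *)

Theorem corollary4p2 (R : realType) (P : 'I_3 -> 'rV[R]_2) (k i j : 'I_3)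
    (alpha : R)
    (ncP : noncollinear P)
    (right_k : vertex_angle P k = pi / 2)
    (acute_i : i != k) (angle_i : vertex_angle P i = alpha / 2)
    (irr_alpha : ~ exists q : rat, alpha = ratr q * pi)
    (leg_j : j != k) :
  (lower_box_dim
     [set x | side P j x /\ ~ periodic_orbit P (x, inner_normal P j)]
   <= (1 / 2)%:E)%E.
Proof.
have injP := noncollinear_inj _ _ ncP.
have kj : k != j by rewrite eq_sym.
have [m km jm] : exists2 m : 'I_3, k != m & j != m.
  case: (ord3_cases k j) leg_j => ->; rewrite ?eqxx // => _.
    by exists (k - 1); rewrite 1?eq_sym ord3_neq.
  by exists (k + 1); rewrite 1?eq_sym ord3_neq.
have mj : m != j by rewrite eq_sym.
have mk : m != k by rewrite eq_sym.
have [u uE] : exists u, P m - P k = u by eexists.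
have [w wE] : exists w, P j - P k = w by eexists.
have wuE : P j - P m = w - u by rewrite -uE -wE opprB addrA subrK.
have u0 : u != 0 by rewrite -uE subr_eq0; apply: contraNneq mk => /injP ->.
have w0 : w != 0 by rewrite -wE subr_eq0; apply: contraNneq leg_j => /injP ->.
have a0 : 0 < enorm u by rewrite enorm_gt0.
have b0 : 0 < enorm w by rewrite enorm_gt0.
set a := enorm u in a0; set b := enorm w in b0.
have uw : dot u w = 0.
  have := cos_angle _ u w; rewrite -uE -wE -vertex_angleE // right_k cos_pihalf uE wE.
  move/eqP; rewrite eq_sym mulf_eq0 invr_eq0 (gt_eqF (mulr_gt0 a0 b0)) orbF.
  by move/eqP.
pose c := enorm (w - u).
have wu0 : w - u != 0.
  by rewrite -wuE subr_eq0; apply: contraNneq jm => /injP ->.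
have c0 : 0 < c by rewrite enorm_gt0.
have aE : dot u u = a ^+ 2 by rewrite -enorm_sqr.
have bE : dot w w = b ^+ 2 by rewrite -enorm_sqr.
have cE : c ^+ 2 = a ^+ 2 + b ^+ 2.
  by rewrite enorm_sqr !dotL aE bE uw (dotC _ w u) uw; ring.
pose th := angle (- u) (w - u).
have cos_th : cos th = a / c.
  rewrite cos_angle !dotL aE uw; have -> : enorm (- u) = a.
    by rewrite /enorm dotNl dotNr opprK.
  by rewrite -/c; field; rewrite !gt_eqF.
have th_itv : 0 <= th <= pi by have [] := acos_def (cosine_itv _ (- u) (w - u)).
have pi0 := pi_gt0 R.
have th_acute : th < pi / 2.
  rewrite -ltr_cos ?in_itv /= ?th_itv //; last by apply/andP; split; lra.
  by rewrite cos_pihalf cos_th divr_gt0.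
have sin_th : sin th = b / c.
  have s0 : 0 <= sin th by rewrite sin_ge0_pi.
  have bc0 : 0 < b / c by rewrite divr_gt0.
  have : (sin th - b / c) * (sin th + b / c) = 0.
    rewrite -subr_sqr sin2cos2 cos_th !exprMn exprVn cE; field.
    by rewrite -cE sqrf_eq0 gt_eqF.
  move/eqP; rewrite mulf_eq0 subr_eq0 => /orP[/eqP //|/eqP e].
  by move: (ltr_wpDl s0 bc0); rewrite e ltxx.
have alphaE : alpha = 2 * th \/ alpha = pi - 2 * th.
  case: (ord3_cover _ _ _ kj km jm i) acute_i => iE; rewrite iE ?eqxx // => _; [right|left].
    have e : vertex_angle P j = angle (- w) (u - w).
      rewrite (vertex_angleE _ _ j k m) // -[P k - P j]opprB -[P m - P j]opprB wE wuE.
      by rewrite opprB.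
    suff : alpha / 2 = pi / 2 - th by move=> h; lra.
    have th2 : 0 <= pi / 2 - th <= pi by case/andP: th_itv => *; apply/andP; split; lra.
    have g : 0 <= alpha / 2 <= pi.
      by rewrite -angle_i iE e; have [] := acos_def (cosine_itv _ (- w) (u - w)).
    apply: cos_inj; rewrite ?in_itv //= cosB cos_pihalf sin_pihalf mul0r mul1r add0r.
    rewrite sin_th -angle_i iE e cos_angle !dotL bE (dotC _ w u) uw.
    have -> : enorm (- w) = b by rewrite /enorm dotNl dotNr opprK.
    have -> : enorm (u - w) = c by rewrite -opprB /enorm dotNl dotNr opprK.
    by field; rewrite !gt_eqF.
  have e : vertex_angle P m = th.
    by rewrite (vertex_angleE _ _ m k j) // /th -[P k - P m]opprB uE wuE.
  by move: angle_i; rewrite iE e => h; lra.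
have irr (q : nat) (p : int) : (0 < q)%N -> q%:R * (2 * th / pi) != p%:~R.
  move=> q0; apply/eqP => e; apply: irr_alpha.
  have qR : q%:R != 0 :> R by rewrite pnatr_eq0 -lt0n.
  have th2 : 2 * th = p%:~R / q%:R * pi.
    by rewrite -e; move: (pi : R) pi0 => Q Q0; field; rewrite qR gt_eqF.
  have [x xE] : exists x : rat, ratr x = p%:~R / q%:R :> R.
    by exists (p%:~R / q%:R); rewrite fmorph_div /= ratr_int ratr_nat.
  case: alphaE => ->; rewrite th2; first by exists x; rewrite xE.
  by exists (1 - x); rewrite rmorphB rmorph1 /= xE mulrBl mul1r.
have [] := @nonperiodic_covering R P k j m (a^-1 *: u) (b^-1 *: w) a b c th
  kj km jm injP _ _ _ a0 b0 c0 _ _ cos_th sin_th irr.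
- by rewrite dotZl dotZr aE; field; rewrite gt_eqF.
- by rewrite dotZl dotZr bE; field; rewrite gt_eqF.
- by rewrite dotZl dotZr uw !mulr0.
- by rewrite scalerA mulfV ?gt_eqF // scale1r -uE addrC subrK.
- by rewrite scalerA mulfV ?gt_eqF // scale1r -wE addrC subrK.
move=> C; exact: lower_box_dim_le_half.
Qed.
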